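(* Let $D$ be a domain in $\mathbb{C}^n$, let $\mathcal{F}$ be a family of holomorphic functions on $D$, and let $k$ be a positive integer. If for every $f\in\mathcal{F}$, every $z\in D$ and every $v=(v_1,\dots,v_n)\in\mathbb{C}^n$ with $\|v\|=1$ we have $f(z)\neq 0$ and $(D^kf(z),v)\neq 1$, then $\mathcal{F}$ is normal in $D$.
   Context: $D^k$ denotes the operator $\left(\frac{\partial^k}{\partial z_1^k},\dots,\frac{\partial^k}{\partial z_n^k}\right)$, and $(D^kf(z),v)=\sum_{j=1}^n \frac{\partial^k f}{\partial z_j^k}(z)\,v_j$. $\|\cdot\|$ is the Euclidean norm. A family of holomorphic functions on $D$ is normal in $D$ if every sequence in it has a subsequence converging locally uniformly in $D$.
   Formalization: ''Normal'' is taken to allow a subsequence tending locally uniformly to infinity as well as one converging to a finite function; with finite limits only the claim fails, e.g. for the constant functions f_m = m. *)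

(* Defs.v *)
From HB Require Import structures.
From mathcomp Require Import all_boot all_order all_algebra.
From mathcomp Require Import all_classical all_reals all_analysis.
From mathcomp Require Import complex.
Set Implicit Arguments. Unset Strict Implicit. Unset Printing Implicit Defensive.
Import Order.TTheory GRing.Theory Num.Theory.
Import numFieldNormedType.Exports.
Local Open Scope classical_set_scope.
Local Open Scope ring_scope.

(* Canonical topological / normed-field structure on C := R[i] (the library
   only provides these generically via R^o; we copy them onto R[i]). *)
Set Warnings "-redundant-canonical-projection".
Section Cinst. Variable R : realType.
HB.instance Definition _ := PseudoPointedMetric.copy R[i] R[i]^o.
HB.instance Definition _ := GRing.ComAlgebra.copy R[i] R[i]^o.
HB.instance Definition _ := NormedModule.copy R[i] R[i]^o.
End Cinst.

(* The complex numbers C := R[i] over a real field R : realType;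
   C^n is represented by row vectors 'rV[R[i]]_n (product/sup-norm topology,
   which coincides with the Euclidean topology). *)

(* f : C^n -> C is holomorphic on D : complex (Frechet) differentiable,
   over the scalar field C, at every point of D. *)
Definition holomorphic_on (R : realType) (n : nat)
    (D : set 'rV[R[i]]_n) (f : 'rV[R[i]]_n -> R[i]) : Prop :=
  forall z, D z -> differentiable f z.

Definition domain (R : realType) (n : nat) (D : set 'rV[R[i]]_n) : Prop :=
  open D /\ connected D /\ D !=set0.

Definition partial (R : realType) (n : nat) (j : 'I_n)
    (f : 'rV[R[i]]_n -> R[i]) : 'rV[R[i]]_n -> R[i] :=
  fun z => 'D_(delta_mx 0 j) f z.

Definition partialk (R : realType) (n : nat) (k : nat) (j : 'I_n)
    (f : 'rV[R[i]]_n -> R[i]) : 'rV[R[i]]_n -> R[i] :=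
  iter k (partial j) f.

Definition Dk_pair (R : realType) (n : nat) (k : nat)
    (f : 'rV[R[i]]_n -> R[i]) (z v : 'rV[R[i]]_n) : R[i] :=
  \sum_(j < n) partialk k j f z * v 0 j.

Definition eucl_norm (R : realType) (n : nat) (v : 'rV[R[i]]_n) : R :=
  Num.sqrt (\sum_(j < n) (complex.Re (v 0 j) ^+ 2 + complex.Im (v 0 j) ^+ 2)).

Definition normal_family (R : realType) (n : nat) (D : set 'rV[R[i]]_n)
    (F : set ('rV[R[i]]_n -> R[i])) : Prop :=
  forall u : nat -> ('rV[R[i]]_n -> R[i]), (forall m, F (u m)) ->
  exists sigma : nat -> nat, (forall m, (sigma m < sigma m.+1)%N) /\
   ((exists g : 'rV[R[i]]_n -> R[i],
       forall K, K `<=` D -> compact K ->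
       forall e : R, 0 < e ->
       \forall m \near \oo, forall z, K z -> `|u (sigma m) z - g z| < (e%:C)%C)
    \/
    (forall K, K `<=` D -> compact K ->
       forall M : R,
       \forall m \near \oo, forall z, K z -> (M%:C)%C < `|u (sigma m) z|)).

(* Main.v *)
Require Import Defs.
From HB Require Import structures.
From mathcomp Require Import all_boot all_order all_algebra.
From mathcomp Require Import all_classical all_reals all_analysis.
From mathcomp Require Import complex ring lra.
Set Implicit Arguments. Unset Strict Implicit. Unset Printing Implicit Defensive.
Import Order.TTheory GRing.Theory Num.Theory.
Import numFieldNormedType.Exports.
Local Open Scope classical_set_scope.
Local Open Scope ring_scope.

(* Testing with multiples of the coordinate vectors shows that
   [|d^k f / d z_j^k|] never equals 1, so on a small polydisc every coordinate
   slice of [f] is a zero-free holomorphic function [g] of one variable with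
   either [|g^(k)| <= 1] or [|g^(k)| >= 1] throughout a disc.  Both cases give a
   Harnack-type bound [|g y| <= Phi |g x|] on a smaller disc, with [Phi]
   independent of [g]:
   - if [|g^(k)| <= 1], Taylor's formula bounds [|g|] on the disc by its supremum
     on a small disc; there zero-freeness gives, through Borel-Caratheodory for
     [log g], the bound [sqrt (M |g x|)] with [M] a bound on the large disc;
   - if [|g^(k)| >= 1], then [|g|] is bounded below: a small value [|g x|] yields
     by Cauchy's estimate for [g^(k)] points [x_i] with
     [|g x_(i+1)| <= |g x_i|^2], converging to a zero of [g]; now apply
     Borel-Caratheodory to [1/g].
   Moving one coordinate at a time, boundedness, respectively divergence to
   infinity, of a sequence at one point spreads along the connected set [D],
   and a locally bounded sequence has a convergent subsequence.

   Cauchy's theory is derived without integrals: Goursat's bisection is run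
   directly on the dyadic trapezoid sums [sint f n a b] approximating the
   integral of [f] over the segment [a, b]. *)

(** * Complex modulus and bisection of triangles *)

(** The one-variable analysis rests on a single compactness tool, bisection of a triangle inside a
    closed convex set; degenerate triangles make it serve for segments too, as mean value inequality
    and as connectedness. Trapezoid sums are exactly additive under bisection, so Goursat's theorem
    is a statement about all large levels, and limits of the sums are taken only to build
    primitives. Cauchy's estimate meets an obstacle: its contour surrounds a pole, while Goursat is
    available only on convex sets that avoid it. Symmetrizing the integrand under quarter turns
    reduces the contour to one edge of a square, which such a set contains. In the case of a small
    derivative the bound by sqrt (M |g x|) matters because it is sublinear in M: up to a multiple of
    |g x| it is absorbed into M / 2, and the finite but uncontrolled M drops out. Nothing is known
    about mixed derivatives, and either alternative for the k-th derivative may occur on each slice;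
    one monotone function [Phi] therefore has to serve both, uniformly over all slices. *)

Local Notation cn := Normc.normc.

Section ComplexNorm.
Variable R : realType.
Implicit Types (x y z w : R[i]) (a b e d : R).

Lemma cn_norm z : `|z| = ((cn z)%:C)%C.
Proof. by []. Qed.

Lemma cn_ge0 z : 0 <= cn z.
Proof. by case: z => a b; rewrite sqrtr_ge0. Qed.

Lemma cn0 : cn (0 : R[i]) = 0.
Proof. exact: Normc.normc0. Qed.

Lemma cn1 : cn (1 : R[i]) = 1.
Proof. exact: Normc.normc1. Qed.

Lemma cnN z : cn (- z) = cn z.
Proof. exact: normcN. Qed.

Lemma cnD x y : cn (x + y) <= cn x + cn y.
Proof. exact: le_normcD. Qed.

Lemma cnB x y : cn (x - y) = cn (y - x).
Proof. by rewrite -opprB cnN. Qed.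

Lemma cnM x y : cn (x * y) = cn x * cn y.
Proof. exact: Normc.normcM. Qed.

Lemma cnV x : cn x^-1 = (cn x)^-1.
Proof. exact: Normc.normcV. Qed.

Lemma cnX x n : cn (x ^+ n) = cn x ^+ n.
Proof. by elim: n => [|n IH]; rewrite ?expr0 ?cn1// !exprS cnM IH. Qed.

Lemma cn_real a : cn (a%:C)%C = `|a|.
Proof. by rewrite /= expr0n/= addr0 sqrtr_sqr. Qed.

Lemma cn_nat n : cn (n%:R : R[i]) = n%:R.
Proof.
have -> : (n%:R : R[i]) = ((n%:R : R)%:C)%C by rewrite rmorph_nat.
by rewrite cn_real normr_nat.
Qed.

Lemma cn_eq0 z : (cn z == 0) = (z == 0).
Proof.
by apply/eqP/eqP => [/Normc.eq0_normc //|->]; rewrite cn0.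
Qed.

Lemma cn_gt0 z : (0 < cn z) = (z != 0).
Proof. by rewrite lt0r cn_eq0 cn_ge0 andbT. Qed.

Lemma cnDB x y : cn x - cn y <= cn (x - y).
Proof. by have := cnD (x - y) y; rewrite subrK lerBlDr. Qed.

Lemma cn_tri z x y : cn (x - y) <= cn (x - z) + cn (z - y).
Proof. by have := cnD (x - z) (z - y); rewrite addrA subrK. Qed.

Lemma Re_le_cn z : `|complex.Re z| <= cn z.
Proof.
case: z => a b /=; rewrite -sqrtr_sqr ler_sqrt ?addr_ge0 ?sqr_ge0//.
by rewrite lerDl sqr_ge0.
Qed.

Lemma Im_le_cn z : `|complex.Im z| <= cn z.
Proof.
case: z => a b /=; rewrite -sqrtr_sqr ler_sqrt ?addr_ge0 ?sqr_ge0//.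
by rewrite lerDr sqr_ge0.
Qed.

Lemma cn_le_ReIm z : cn z <= `|complex.Re z| + `|complex.Im z|.
Proof.
case: z => a b /=; have ab0 : 0 <= `|a| + `|b| by rewrite addr_ge0.
rewrite -(ger0_norm ab0) -sqrtr_sqr ler_sqrt ?sqr_ge0// sqrrD !real_normK ?num_real//.
by rewrite addrAC lerDl mulrn_wge0// mulr_ge0.
Qed.

Lemma cn_mid_dist a x y : cn ((x + y) / 2 - x) = cn (y - x) / 2.
Proof.
have -> : (x + y) / 2 - x = (y - x) / 2 by field.
by rewrite cnM cnV cn_nat.
Qed.

End ComplexNorm.

Section Bisection.
Variable R : realType.
Implicit Types (a b c p : R[i]) (e d s D : R).

Lemma dependent_choice_rel (T : Type) (Q : nat -> T -> Prop)
    (S : nat -> T -> T -> Prop) (t0 : T) :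
  Q 0%N t0 -> (forall n t, Q n t -> exists2 t', Q n.+1 t' & S n t t') ->
  exists2 u : nat -> T, u 0%N = t0 &
    forall n, Q n (u n) /\ S n (u n) (u n.+1).
Proof.
move=> Q0 step.
have nextP (n : nat) (t : T) : {t' | Q n t -> Q n.+1 t' /\ S n t t'}.
  apply: cid; have [/step[t' ? ?]|nQ] := pselect (Q n t); first by exists t'.
  by exists t => /nQ.
pose u := fix u n := if n is m.+1 then sval (nextP m (u m)) else t0.
exists u => // n.
suff Qn : Q n (u n) by have [] := svalP (nextP n (u n)) Qn.
by elim: n => // n IH; have [] := svalP (nextP n (u n)) IH.
Qed.

(** The intervals of radius 2 D / 2^n about [x n] are nested, so the supremum of their left ends
    lies in all of them. *)
Lemma fast_cauchy_real (x : nat -> R) D :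
  (forall n, `|x n.+1 - x n| <= D / 2 ^+ n) ->
  exists l, forall n, `|x n - l| <= 2 * D / 2 ^+ n.
Proof.
move=> hx.
have half n : D / 2 ^+ n = 2 * D / 2 ^+ n - 2 * D / 2 ^+ n.+1.
  by rewrite exprS invfM; move: (_ ^- n) => t; field.
have lo n m : x n - 2 * D / 2 ^+ n <= x (n + m)%N - 2 * D / 2 ^+ (n + m).
  elim: m => [|m IH]; first by rewrite addn0.
  rewrite addnS; have := hx (n + m)%N; rewrite ler_norml half => /andP[].
  by move: IH; lra.
have hi n m : x (n + m)%N + 2 * D / 2 ^+ (n + m) <= x n + 2 * D / 2 ^+ n.
  elim: m => [|m IH]; first by rewrite addn0.
  rewrite addnS; have := hx (n + m)%N; rewrite ler_norml half => /andP[].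
  by move: IH; lra.
have D0 : 0 <= D by have := le_trans (normr_ge0 _) (hx 0%N); rewrite expr0 divr1.
have e0 n : 0 <= 2 * D / 2 ^+ n by rewrite divr_ge0 ?mulr_ge0 ?exprn_ge0.
have ub n m : x m - 2 * D / 2 ^+ m <= x n + 2 * D / 2 ^+ n.
  have := lo m n; have := hi n m; rewrite addnC; have := e0 (m + n)%N; lra.
pose A := range (fun n => x n - 2 * D / 2 ^+ n).
have Aub n : ubound A (x n + 2 * D / 2 ^+ n) by move=> _ [m _ <-]; apply: ub.
have A0 : A !=set0 by exists (x 0%N - 2 * D / 2 ^+ 0), 0%N.
exists (sup A) => n.
have h1 : x n - 2 * D / 2 ^+ n <= sup A.
  by apply: ub_le_sup; [exists (x 0%N + 2 * D / 2 ^+ 0)|exists n].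
have h2 : sup A <= x n + 2 * D / 2 ^+ n by apply: ge_sup.
by rewrite ler_distlC; apply/andP; split; lra.
Qed.

Lemma fast_cauchy (x : nat -> R[i]) D :
  (forall n, cn (x n.+1 - x n) <= D / 2 ^+ n) ->
  exists p, forall n, cn (x n - p) <= 4 * D / 2 ^+ n.
Proof.
move=> hx.
have [|l hl] := @fast_cauchy_real (fun n => complex.Re (x n)) D.
  move=> n; apply: le_trans (hx n); apply: le_trans (Re_le_cn _).
  by rewrite raddfB.
have [|m hm] := @fast_cauchy_real (fun n => complex.Im (x n)) D.
  move=> n; apply: le_trans (hx n); apply: le_trans (Im_le_cn _).
  by rewrite raddfB.
exists (l +i* m)%C => n; apply: le_trans (cn_le_ReIm _) _.
rewrite !raddfB/=; have := hl n; have := hm n.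
have -> : 4 * D = 2 * D + 2 * D by ring.
rewrite mulrDl; lra.
Qed.

Lemma geometric_lt D e : 0 < e -> exists n, D / 2 ^+ n < e.
Proof.
move=> e0; exists (Num.bound (D / e)).
by rewrite ltr_pdivrMr ?exprn_gt0// -ltr_pdivrMl// mulrC upper_nthrootP.
Qed.

Definition mid a b : R[i] := (a + b) / 2.

(** Closed convexity in the form that bisection consumes: only midpoints and limits of points of [B]
    are ever formed. *)
Definition mid_closed (B : R[i] -> Prop) :=
  (forall a b, B a -> B b -> B (mid a b)) /\
  (forall p, (forall e, 0 < e -> exists2 x, B x & cn (x - p) < e) -> B p).

(* [s] is the scale of the triangle [abc]; it halves at each subdivision into
   four congruent triangles. *)
Lemma triangle_bisection (B : R[i] -> Prop)
    (P : R -> R[i] -> R[i] -> R[i] -> Prop) :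
  mid_closed B ->
  (forall s a b c, 0 < s -> B a -> B b -> B c ->
    P (s / 2) a (mid a b) (mid a c) -> P (s / 2) (mid a b) b (mid b c) ->
    P (s / 2) (mid a c) (mid b c) c ->
    P (s / 2) (mid a b) (mid b c) (mid a c) -> P s a b c) ->
  (forall p, B p -> exists2 d, 0 < d & forall s a b c, 0 < s -> s < d ->
    B a -> B b -> B c -> cn (a - p) <= s -> cn (b - p) <= s ->
    cn (c - p) <= s -> P s a b c) ->
  forall s a b c, 0 < s -> B a -> B b -> B c -> cn (b - a) <= s / 3 ->
    cn (c - b) <= s / 3 -> cn (c - a) <= s / 3 -> P s a b c.
Proof.
move=> [Bmid Bcl] sub loc s a0 b0 c0 s0 Ba Bb Bc hab hbc hac.
apply: contrapT => nP.
(* Descent on a counterexample: if [P] fails on a triangle, it fails on one of its four parts, whose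
   sides are half as long. *)
pose Q n (t : R[i] * R[i] * R[i]) := let: (a, b, c) := t in
  [/\ B a, B b & B c] /\ [/\ cn (b - a) <= s / 2 ^+ n / 3,
    cn (c - b) <= s / 2 ^+ n / 3 & cn (c - a) <= s / 2 ^+ n / 3] /\
  ~ P (s / 2 ^+ n) a b c.
(* The first vertex moves by at most half a side, (s / 3) / 2 at scale [s], so these vertices
   converge, to a point [p] that stays in [B]. *)
pose S n (t t' : R[i] * R[i] * R[i]) :=
  cn (t'.1.1 - t.1.1) <= (s / 6) / 2 ^+ n.
have [||u u0 hu] := @dependent_choice_rel _ Q S (a0, b0, c0).
- by rewrite /Q expr0 !divr1.
- move=> n [[a b] c] [[ha hb hc] [[h1 h2 h3] h4]].
  have sn0 : 0 < s / 2 ^+ n by rewrite divr_gt0 ?exprn_gt0.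
  have sn : s / 2 ^+ n.+1 = s / 2 ^+ n / 2 by rewrite exprS invfM mulrA mulrAC.
  have Bab := Bmid _ _ ha hb; have Bac := Bmid _ _ ha hc.
  have Bbc := Bmid _ _ hb hc.
  have s6 : s / 6 / 2 ^+ n = s / 2 ^+ n / 3 / 2 by move: (_ ^- n) => t; field.
  have half (x y : R[i]) : cn y <= s / 2 ^+ n / 3 -> x = y / 2 \/ x = - (y / 2)
      -> cn x <= s / 2 ^+ n / 2 / 3.
    have -> : s / 2 ^+ n / 2 / 3 = s / 2 ^+ n / 3 / 2 by rewrite mulrAC.
    by move=> hy [|] ->; rewrite ?cnN cnM cnV cn_nat ler_pM2r ?invr_gt0.
  have mab : cn (mid a b - a) <= s / 2 ^+ n / 2 / 3.
    by apply: (half _ (b - a)) => //; left; rewrite /mid; field.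
  have mac : cn (mid a c - a) <= s / 2 ^+ n / 2 / 3.
    by apply: (half _ (c - a)) => //; left; rewrite /mid; field.
  have e6 : s / 2 ^+ n / 3 / 2 = s / 2 ^+ n / 2 / 3 by rewrite mulrAC.
  have [p1|n1] := pselect (P (s / 2 ^+ n / 2) a (mid a b) (mid a c)); last first.
    exists (a, mid a b, mid a c); last by rewrite /S/= subrr cn0 s6; move: sn0; lra.
    rewrite /Q sn; split=> //; split=> //; split=> //.
    by apply: (half _ (c - b)) => //; left; rewrite /mid; field.
  have [p2|n2] := pselect (P (s / 2 ^+ n / 2) (mid a b) b (mid b c)); last first.
    exists (mid a b, b, mid b c); last by rewrite /S/= s6 e6.
    rewrite /Q sn; split=> //; split=> //; split.
    + by apply: (half _ (b - a)) => //; left; rewrite /mid; field.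
    + by apply: (half _ (c - b)) => //; left; rewrite /mid; field.
    + by apply: (half _ (c - a)) => //; left; rewrite /mid; field.
  have [p3|n3] := pselect (P (s / 2 ^+ n / 2) (mid a c) (mid b c) c); last first.
    exists (mid a c, mid b c, c); last by rewrite /S/= s6 e6.
    rewrite /Q sn; split=> //; split=> //; split.
    + by apply: (half _ (b - a)) => //; left; rewrite /mid; field.
    + by apply: (half _ (c - b)) => //; left; rewrite /mid; field.
    + by apply: (half _ (c - a)) => //; left; rewrite /mid; field.
  have [p4|n4] := pselect (P (s / 2 ^+ n / 2) (mid a b) (mid b c) (mid a c)).
    by case: h4; apply: sub.
  exists (mid a b, mid b c, mid a c); last by rewrite /S/= s6 e6.
  rewrite /Q sn; split=> //; split=> //; split.
  + by apply: (half _ (c - a)) => //; left; rewrite /mid; field.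
  + by apply: (half _ (b - a)) => //; right; rewrite /mid; field.
  + by apply: (half _ (c - b)) => //; left; rewrite /mid; field.
have [p hp] : exists p, forall n, cn ((u n).1.1 - p) <= 4 * (s / 6) / 2 ^+ n.
  by apply: fast_cauchy => n; have [_] := hu n.
have Bp : B p.
  apply: Bcl => e e0; have [n hn] := @geometric_lt (4 * (s / 6)) _ e0.
  have [] := hu n; case: (u n) (hp n) => [[a b] c]/= ha [[Ba' _ _] _] _.
  by exists a => //; apply: le_lt_trans ha hn.
have [d d0 hd] := loc p Bp.
have [n hn] := @geometric_lt s _ d0.
have [] := hu n; case: (u n) (hp n) => [[a b] c]/= ha [[Ba' Bb' Bc']] [[h1 h2 h3]].
move=> + _; apply; have sn0 : 0 < s / 2 ^+ n by rewrite divr_gt0 ?exprn_gt0.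
(* The first vertex is within 2/3 of the scale from [p] and the sides are at most 1/3 of it, so all
   vertices are within the full scale: hence the bound [s / 3] on the sides. *)
have e1 : 4 * (s / 6) / 2 ^+ n = s / 2 ^+ n * (2 / 3) by move: (_ ^- n) => t; field.
move: ha; rewrite e1 => ha.
apply: hd => //.
- by move: ha; lra.
- by have := cn_tri a b p; move: ha h1; lra.
- by have := cn_tri a c p; move: ha h3; lra.
Qed.

End Bisection.

(** * Goursat's theorem for dyadic sums *)

Section Goursat.
Variable R : realType.
Implicit Types (a b c p u v z w l : R[i]) (e d s D : R) (f g : R[i] -> R[i]).
Implicit Types B : R[i] -> Prop.

(** The complex derivative with every bound in the real field, where [lra] works; [derivable_cderiv]
    and [cderiv_derive] translate to and from the derivative of the library. *)
Definition cderiv f z l := forall e, 0 < e -> exists2 d, 0 < d &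
  forall w, cn (w - z) < d -> cn (f w - f z - l * (w - z)) <= e * cn (w - z).

Lemma cn_mid_le p a b s :
  cn (a - p) <= s -> cn (b - p) <= s -> cn (mid a b - p) <= s.
Proof.
move=> ha hb; have -> : mid a b - p = ((a - p) + (b - p)) / 2.
  by rewrite /mid; field.
by rewrite cnM cnV cn_nat; have := cnD (a - p) (b - p); lra.
Qed.

Lemma mid_closed_disc p s : mid_closed (fun z => cn (z - p) <= s).
Proof.
split=> [a b|q hq]; first exact: cn_mid_le.
apply/ler_addgt0Pr => e e0; have [x hx xq] := hq e e0.
by have := cn_tri x q p; rewrite (cnB q x); lra.
Qed.

Lemma mid_closedI (B B' : R[i] -> Prop) :
  mid_closed B -> mid_closed B' -> mid_closed (fun z => B z /\ B' z).
Proof.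
move=> [m1 c1] [m2 c2]; split=> [a b [? ?] [? ?]|p hp]; first by split; auto.
by split; [apply: c1|apply: c2] => e /hp[x [? ?] ?]; exists x.
Qed.

Lemma mid_closed_halfplane u s : mid_closed (fun z => s <= complex.Re (u * z)).
Proof.
have reM2 (x : R[i]) : complex.Re (x / 2) = complex.Re x / 2.
  have -> : x / 2 = x * (2^-1 : R)%:C%C by rewrite fmorphV rmorph_nat.
  by case: x => x y /=; rewrite mulr0 subr0.
split=> [a b ha hb|q hq].
  have -> : u * mid a b = (u * a + u * b) / 2 by rewrite /mid; field.
  by rewrite reM2 raddfD/=; lra.
apply/ler_addgt0Pr => e e0; have u0 : 0 < cn u + 1 by rewrite ltr_wpDl ?cn_ge0.
have [x hx xq] := hq (e / (cn u + 1)) (divr_gt0 e0 u0).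
have h : `|complex.Re (u * x) - complex.Re (u * q)| <= e.
  rewrite -raddfB -mulrBr; apply: le_trans (Re_le_cn _) _; rewrite cnM.
  move: xq; rewrite ltr_pdivlMr// => xq.
  by have := cn_ge0 u; have := cn_ge0 (x - q); nra.
by move: h; rewrite ler_norml => /andP[]; lra.
Qed.

(** The trapezoid rule for the mean of [f] on the segment cut into 2^n equal pieces; recursion on
    halves makes [sintS] an identity. *)
Fixpoint savg f n a b : R[i] :=
  if n is m.+1 then mid (savg f m a (mid a b)) (savg f m (mid a b) b)
  else mid (f a) (f b).

Lemma midC a b : mid a b = mid b a.
Proof. by rewrite /mid addrC. Qed.

Lemma savgC f n a b : savg f n a b = savg f n b a.
Proof.
elim: n a b => [|n IH] a b /=; first exact: midC.
by rewrite midC (IH a) (IH (mid a b)) (midC a b).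
Qed.

(** A trapezoidal mean is formed from values of [f] by midpoints alone, so midpoint-closed
    properties pass to it. *)
Lemma savg_mid_ind B (Q : R[i] -> Prop) f n a b :
  (forall x y, B x -> B y -> B (mid x y)) ->
  (forall x y, Q x -> Q y -> Q (mid x y)) ->
  (forall z, B z -> Q (f z)) -> B a -> B b -> Q (savg f n a b).
Proof.
move=> Bm Qm fQ; elim: n a b => [|n IH] a b Ba Bb /=; first by apply: Qm; auto.
by apply: Qm; apply: IH => //; apply: Bm.
Qed.

(** The rule is exact on affine maps, so only the deviation from the affine map is averaged. *)
Lemma savg_affine B al be e f n a b :
  (forall x y, B x -> B y -> B (mid x y)) ->
  (forall z, B z -> cn (f z - (al + be * z)) <= e) -> B a -> B b ->
  cn (savg f n a b - (al + be * mid a b)) <= e.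
Proof.
move=> Bm fe; elim: n a b => [|n IH] a b Ba Bb /=.
  have -> : mid (f a) (f b) - (al + be * mid a b) =
     mid (f a - (al + be * a)) (f b - (al + be * b)) - 0 by rewrite /mid; field.
  by apply: cn_mid_le; rewrite subr0; apply: fe.
have h1 := IH a (mid a b) Ba (Bm _ _ Ba Bb).
have h2 := IH (mid a b) b (Bm _ _ Ba Bb) Bb.
have := cn_mid_le (p := 0) (s := e); rewrite -[X in cn X <= _]subr0.
set x := savg f n a _; set y := savg f n _ b.
have -> : mid x y - (al + be * mid a b) =
   mid (x - (al + be * mid a (mid a b))) (y - (al + be * mid (mid a b) b)).
  by rewrite /mid; field.
by apply; rewrite subr0.
Qed.

Lemma savg_comp f u n a b :
  savg f n (u * a) (u * b) = savg (fun z => f (u * z)) n a b.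
Proof.
have mM x y : mid (u * x) (u * y) = u * mid x y by rewrite /mid -mulrDr mulrA.
by elim: n a b => [|n IH] a b //=; rewrite mM !IH.
Qed.

Lemma savgZ f u n a b : savg (fun z => u * f z) n a b = u * savg f n a b.
Proof.
have mM x y : mid (u * x) (u * y) = u * mid x y by rewrite /mid -mulrDr mulrA.
by elim: n a b => [|n IH] a b /=; rewrite ?IH mM.
Qed.

Definition sint f n a b := (b - a) * savg f n a b.

Lemma sintS f n a b : sint f n.+1 a b = sint f n a (mid a b) + sint f n (mid a b) b.
Proof. by rewrite /sint/= {1}/mid /mid; field. Qed.

Lemma sintC f n a b : sint f n b a = - sint f n a b.
Proof. by rewrite /sint savgC -mulNr opprB. Qed.

Definition tsum f n a b c := sint f n a b + sint f n b c + sint f n c a.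

(** The inner edges are run through in both directions and cancel. The identity is exact at each
    level, which is what lets these sums replace the integral. *)
Lemma tsumS f n a b c : tsum f n.+1 a b c =
  tsum f n a (mid a b) (mid a c) + tsum f n (mid a b) b (mid b c) +
  tsum f n (mid a c) (mid b c) c + tsum f n (mid a b) (mid b c) (mid a c).
Proof.
rewrite /tsum !sintS (midC c a) (sintC f n (mid a b) (mid a c)).
rewrite (sintC f n (mid a b) (mid b c)) (sintC f n (mid a c) (mid b c)).
by ring.
Qed.

Lemma sint_affine p s al be e f n a b :
  (forall z, cn (z - p) <= s -> cn (f z - (al + be * z)) <= e) ->
  cn (a - p) <= s -> cn (b - p) <= s ->
  cn (sint f n a b - (b - a) * (al + be * mid a b)) <= e * cn (b - a).
Proof.
move=> h ha hb; rewrite /sint -mulrBr cnM mulrC ler_wpM2r ?cn_ge0//.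
by apply: (@savg_affine (fun z => cn (z - p) <= s)) => // x y; apply: cn_mid_le.
Qed.

(** The bound e' s^2 is reproduced by subdivision, since 4 (s / 2)^2 = s^2, the threshold [N]
    growing by one level. Near a point, [f] is within e' s / 6 of its tangent map, whose sum around
    a triangle vanishes; three edges of length at most 2 s then give e' s^2. *)
Lemma goursat B f a b c : mid_closed B ->
  (forall z, B z -> exists l, cderiv f z l) -> B a -> B b -> B c ->
  forall e, 0 < e -> exists N, forall n, (N <= n)%N -> cn (tsum f n a b c) <= e.
Proof.
move=> Bc hf Ba Bb Bcc e e0.
pose s := 3 * (cn (b - a) + cn (c - b) + cn (c - a)) + 1.
have ab0 := cn_ge0 (b - a); have bc0 := cn_ge0 (c - b); have ac0 := cn_ge0 (c - a).
have s0 : 0 < s by rewrite /s; lra.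
pose e' := e / s ^+ 2.
have e'0 : 0 < e' by rewrite divr_gt0// exprn_gt0.
pose P s a b c := exists N, forall n, (N <= n)%N -> cn (tsum f n a b c) <= e' * s ^+ 2.
suff : P s a b c by rewrite /P/e' divfK// expf_neq0// gt_eqF.
apply: (@triangle_bisection _ B) => //; last 3 first.
- by rewrite /s; lra.
- by rewrite /s; lra.
- by rewrite /s; lra.
- move=> t x y z t0 _ _ _ [N1 h1] [N2 h2] [N3 h3] [N4 h4].
  exists (maxn (maxn N1 N2) (maxn N3 N4)).+1 => -[//|n].
  rewrite ltnS !geq_max => /andP[/andP[n1 n2] /andP[n3 n4]]; rewrite tsumS.
  have := h1 _ n1; have := h2 _ n2; have := h3 _ n3; have := h4 _ n4.
  set u1 := tsum _ _ x _ _; set u2 := tsum _ _ _ y _; set u3 := tsum _ _ _ _ z.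
  set u4 := tsum _ _ _ _ _.
  have := cnD (u1 + u2 + u3) u4; have := cnD (u1 + u2) u3; have := cnD u1 u2.
  by rewrite expr_div_n; lra.
- move=> p Bp; have [l hl] := hf p Bp.
  have e6 : 0 < e' / 6 by rewrite divr_gt0.
  have [d d0 hd] := hl _ e6; exists d => // t x y z t0 td _ _ _ hx hy hz.
  have app w : cn (w - p) <= t -> cn (f w - ((f p - l * p) + l * w)) <= e' / 6 * t.
    move=> hw; have -> : f w - (f p - l * p + l * w) = f w - f p - l * (w - p) by ring.
    apply: le_trans (hd _ (le_lt_trans hw td)) _.
    by rewrite ler_wpM2l// ltW.
  exists 0%N => n _.
  have hxy := sint_affine n app hx hy; have hyz := sint_affine n app hy hz.
  have hzx := sint_affine n app hz hx.
  have lxy : cn (y - x) <= 2 * t by have := cn_tri p y x; rewrite (cnB p x); lra.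
  have lyz : cn (z - y) <= 2 * t by have := cn_tri p z y; rewrite (cnB p y); lra.
  have lzx : cn (x - z) <= 2 * t by have := cn_tri p x z; rewrite (cnB p z); lra.
  move: hxy hyz hzx; set k := f p - l * p.
  set u := sint _ _ _ _ - _ => hu; set v := sint _ _ _ _ - _ => hv.
  set w := sint _ _ _ _ - _ => hw.
  have -> : tsum f n x y z = u + v + w by rewrite /tsum /u /v /w /mid; field.
  have := cnD (u + v) w; have := cnD u v.
  have t2 : 0 < e' * t by rewrite mulr_gt0.
  have k1 : e' / 6 * t * cn (y - x) <= e' / 6 * t * (2 * t) by rewrite ler_wpM2l//; lra.
  have k2 : e' / 6 * t * cn (z - y) <= e' / 6 * t * (2 * t) by rewrite ler_wpM2l//; lra.
  have k3 : e' / 6 * t * cn (x - z) <= e' / 6 * t * (2 * t) by rewrite ler_wpM2l//; lra.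
  by rewrite expr2; lra.
Qed.

End Goursat.

(** * Complex derivatives and Cauchy's estimate *)

Section ComplexDerivative.
Variable R : realType.
Implicit Types (a b c p u v z w l m : R[i]) (e d s D : R) (f g : R[i] -> R[i]).

Lemma cderiv_eq_near f g z l d : 0 < d ->
  (forall w, cn (w - z) < d -> f w = g w) -> cderiv f z l -> cderiv g z l.
Proof.
move=> d0 fg hf e e0; have [d' d'0 hd] := hf e e0.
exists (Num.min d d') => [|w]; first by rewrite lt_min d0.
rewrite lt_min => /andP[h1 h2]; rewrite -!fg ?subrr ?cn0//.
exact: hd.
Qed.

Lemma cderiv_cont f z l : cderiv f z l -> forall e, 0 < e ->
  exists2 d, 0 < d & forall w, cn (w - z) < d -> cn (f w - f z) <= e.
Proof.
move=> hf e e0; have [d d0 hd] := hf 1 ltr01.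
have K0 : 0 < 1 + cn l by rewrite ltr_pwDl ?cn_ge0.
exists (Num.min d (e / (1 + cn l))) => [|w]; first by rewrite lt_min d0 divr_gt0.
rewrite lt_min ltr_pdivlMr// => /andP[h1 h2].
have := hd w h1; have := cnD (f w - f z - l * (w - z)) (l * (w - z)).
by rewrite subrK cnM; lra.
Qed.

Lemma cderiv_cst k z : cderiv (fun=> k) z 0.
Proof.
by move=> e e0; exists 1 => // w _; rewrite subrr mul0r subrr cn0 mulr_ge0 ?cn_ge0 ?ltW.
Qed.

Lemma cderiv_id z : cderiv id z 1.
Proof.
by move=> e e0; exists 1 => // w _; rewrite mul1r subrr cn0 mulr_ge0 ?cn_ge0 ?ltW.
Qed.

Lemma cderivD f g z l m :
  cderiv f z l -> cderiv g z m -> cderiv (fun w => f w + g w) z (l + m).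
Proof.
move=> hf hg e e0; have e2 : 0 < e / 2 by rewrite divr_gt0.
have [d1 d10 h1] := hf _ e2; have [d2 d20 h2] := hg _ e2.
exists (Num.min d1 d2) => [|w]; first by rewrite lt_min d10.
rewrite lt_min => /andP[/h1 k1 /h2 k2].
have -> : f w + g w - (f z + g z) - (l + m) * (w - z) =
  (f w - f z - l * (w - z)) + (g w - g z - m * (w - z)) by ring.
by apply: le_trans (cnD _ _) _; lra.
Qed.

Lemma cderivM f g z l m : cderiv f z l -> cderiv g z m ->
  cderiv (fun w => f w * g w) z (l * g z + f z * m).
Proof.
move=> hf hg e e0; have e3 : 0 < e / 3 by rewrite divr_gt0.
have G0 : 0 < cn (g z) + 1 by rewrite ltr_wpDl ?cn_ge0.
have F0 : 0 < cn (f z) + 1 by rewrite ltr_wpDl ?cn_ge0.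
have L0 : 0 < cn l + 1 by rewrite ltr_wpDl ?cn_ge0.
have [d1 d10 h1] := hf _ (divr_gt0 e3 G0).
have [d2 d20 h2] := hg _ (divr_gt0 e3 F0).
have [d3 d30 h3] := cderiv_cont hg (divr_gt0 e3 L0).
have [d4 d40 h4] := cderiv_cont hg ltr01.
exists (Num.min (Num.min d1 d2) (Num.min d3 d4)) => [|w].
  by rewrite !lt_min d10 d20 d30 d40.
rewrite !lt_min => /andP[/andP[/h1 k1 /h2 k2] /andP[/h3 k3 /h4 k4]].
set h := w - z in k1 k2 *.
have -> : f w * g w - f z * g z - (l * g z + f z * m) * h =
  (f w - f z - l * h) * g w + f z * (g w - g z - m * h) + l * h * (g w - g z).
  by ring.
have h0 := cn_ge0 h; have eh : 0 <= e / 3 * cn h by rewrite mulr_ge0// ltW.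
have gw : cn (g w) <= cn (g z) + 1 by have := cnDB (g w) (g z); lra.
have b1 : cn ((f w - f z - l * h) * g w) <= e / 3 * cn h.
  rewrite cnM; apply: le_trans (ler_pM (cn_ge0 _) (cn_ge0 _) k1 gw) _.
  by rewrite mulrAC divfK// gt_eqF.
have b2 : cn (f z * (g w - g z - m * h)) <= e / 3 * cn h.
  have fz : cn (f z) <= cn (f z) + 1 by lra.
  rewrite cnM; apply: le_trans (ler_pM (cn_ge0 _) (cn_ge0 _) fz k2) _.
  by rewrite mulrA mulrCA divff ?mulr1// gt_eqF.
have b3 : cn (l * h * (g w - g z)) <= e / 3 * cn h.
  have ll : cn (l * h) <= (cn l + 1) * cn h by rewrite cnM ler_wpM2r//; lra.
  rewrite cnM; apply: le_trans (ler_pM (cn_ge0 _) (cn_ge0 _) ll k3) _.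
  by rewrite mulrAC mulrCA divff ?mulr1// gt_eqF.
apply: le_trans (cnD _ _) _; have := cnD ((f w - f z - l * h) * g w) (f z * (g w - g z - m * h)).
by lra.
Qed.

Lemma cderivZ u f z l : cderiv f z l -> cderiv (fun w => u * f w) z (u * l).
Proof.
by move=> hf; have := cderivM (cderiv_cst u z) hf; rewrite mul0r add0r.
Qed.

Lemma cderivN f z l : cderiv f z l -> cderiv (fun w => - f w) z (- l).
Proof.
move=> /(cderivZ (-1)); rewrite mulN1r.
by apply: (@cderiv_eq_near _ _ _ _ 1) => // w _; rewrite mulN1r.
Qed.

Lemma cderivB f g z l m :
  cderiv f z l -> cderiv g z m -> cderiv (fun w => f w - g w) z (l - m).
Proof. by move=> hf /cderivN; apply: cderivD. Qed.

Lemma cderivV f z l : f z != 0 -> cderiv f z l ->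
  cderiv (fun w => (f w)^-1) z (- l / f z ^+ 2).
Proof.
move=> fz0 hf e e0; set a := cn (f z).
have a0 : 0 < a by rewrite cn_gt0.
have L0 : 0 < cn l + 1 by rewrite ltr_wpDl ?cn_ge0.
have a2 : 0 < a / 2 by rewrite divr_gt0.
have e1 : 0 < e / 4 * a ^+ 2 by rewrite mulr_gt0 ?exprn_gt0 ?divr_gt0.
have e2 : 0 < e / 4 * a ^+ 3 / (cn l + 1).
  by rewrite divr_gt0// mulr_gt0 ?exprn_gt0 ?divr_gt0.
have [d1 d10 h1] := hf _ e1.
have [d2 d20 h2] := cderiv_cont hf a2.
have [d3 d30 h3] := cderiv_cont hf e2.
exists (Num.min d1 (Num.min d2 d3)) => [|w]; first by rewrite !lt_min d10 d20 d30.
rewrite !lt_min => /andP[/h1 k1 /andP[/h2 k2 /h3 k3]].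
have faw : a / 2 <= cn (f w).
  by have := cnDB (f z) (f w); rewrite (cnB (f z)) -/a; lra.
have fw0 : f w != 0 by rewrite -cn_gt0; lra.
set h := w - z in k1 *.
have -> : (f w)^-1 - (f z)^-1 - - l / f z ^+ 2 * h =
  l * h * (f w - f z) / (f w * f z ^+ 2) - (f w - f z - l * h) / (f w * f z).
  by field; rewrite fz0 fw0.
have h0 := cn_ge0 h.
have b1 : cn ((f w - f z - l * h) / (f w * f z)) <= e / 2 * cn h.
  rewrite cnM cnV cnM -/a ler_pdivrMr; last by rewrite mulr_gt0//; lra.
  apply: (le_trans k1).
  have : e / 2 * cn h * a * (a / 2) <= e / 2 * cn h * a * cn (f w).
    by rewrite ler_wpM2l// !mulr_ge0 ?invr_ge0// ltW.
  by rewrite expr2; lra.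
have b2 : cn (l * h * (f w - f z) / (f w * f z ^+ 2)) <= e / 2 * cn h.
  rewrite cnM cnV !cnM -/a ler_pdivrMr; last by rewrite !mulr_gt0//; lra.
  have k4 : cn l * cn (f w - f z) <= e / 4 * a ^+ 3.
    move: k3; rewrite ler_pdivlMr// => k3; apply: le_trans k3.
    by rewrite mulrC ler_wpM2l ?cn_ge0//; lra.
  have k5 : cn l * cn (f w - f z) * cn h <= e / 4 * a ^+ 3 * cn h by rewrite ler_wpM2r.
  have k6 : e / 2 * cn h * a ^+ 2 * (a / 2) <= e / 2 * cn h * a ^+ 2 * cn (f w).
    by rewrite ler_wpM2l// !mulr_ge0 ?exprn_ge0 ?invr_ge0// ltW.
  by move: k5 k6; rewrite exprS expr2; lra.
by apply: le_trans (cnD _ _) _; rewrite cnN; lra.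
Qed.

Lemma cderiv_affine f c u z l : cderiv f (c + u * z) l ->
  cderiv (fun w => f (c + u * w)) z (u * l).
Proof.
move=> hf e e0; have U0 : 0 < cn u + 1 by rewrite ltr_wpDl ?cn_ge0.
have [d d0 hd] := hf _ (divr_gt0 e0 U0).
exists (d / (cn u + 1)) => [|w]; first by rewrite divr_gt0.
rewrite ltr_pdivlMr// => hw.
have e1 : c + u * w - (c + u * z) = u * (w - z) by ring.
have u1 : cn u * cn (w - z) <= cn (w - z) * (cn u + 1).
  by have := cn_ge0 (w - z); lra.
have := hd (c + u * w); rewrite e1 cnM => /(_ (le_lt_trans u1 hw)).
rewrite mulrA [l * u]mulrC => h; apply: (le_trans h).
by rewrite mulrAC ler_pdivrMr// -mulrA ler_wpM2l// ltW.
Qed.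

End ComplexDerivative.

(** * Cauchy's estimate from one edge of a square *)

Section CauchyEstimate.
Variable R : realType.
Implicit Types (a b c p u v z w l m : R[i]) (e d s D : R) (f g : R[i] -> R[i]).

Lemma ReM_le u z : complex.Re (u * z) <= cn u * cn z.
Proof. by rewrite -cnM; apply: le_trans (Re_le_cn _); rewrite ler_norm. Qed.

Lemma savg_close (B : R[i] -> Prop) f g e n a b :
  (forall x y, B x -> B y -> B (mid x y)) ->
  (forall z, B z -> cn (f z - g z) <= e) -> B a -> B b ->
  cn (savg f n a b - savg g n a b) <= e.
Proof.
have midB (x y x' y' : R[i]) : mid x y - mid x' y' = mid (x - x') (y - y') - 0.
  by rewrite /mid; field.
move=> Bm fg; elim: n a b => [|n IH] a b Ba Bb /=; rewrite midB.
  by apply: cn_mid_le; rewrite subr0; apply: fg.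
by apply: cn_mid_le; rewrite subr0; apply: IH => //; apply: Bm.
Qed.

Let J : R[i] := 'i%C.

Let JJ : J * J = -1.
Proof. by rewrite -expr2 sqr_i. Qed.

Let cnJ : cn J = 1.
Proof. by rewrite /J/= expr0n/= expr1n add0r sqrtr1. Qed.

Variables (f : R[i] -> R[i]) (r M : R) (l : R[i]).
Hypothesis hol : forall z, cn z < r -> exists m, cderiv f z m.
Hypothesis bnd : forall z, cn z < r -> cn (f z) <= M.
Hypothesis f0 : cderiv f 0 l.

(** The integral of f(z) / z^2 around the square with vertices t, J t, -t, -J t, folded onto the
    edge from t to J t: substituting J^m z on the m-th edge turns the integrand into J^(-m) f(J^m z)
    / z^2. The sum over the four edges is [G]. *)
Let num z := f z - J * f (J * z) - f (- z) + J * f (- J * z).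
Let G z := num z / z ^+ 2.

(** Invariance of the form G(z) dz under the quarter turn; the case z = 0 holds by the convention
    that 0 has inverse 0. *)
Let G_rot z : J * G (J * z) = G z.
Proof.
have [->|z0] := eqVneq z 0; first by rewrite mulr0 /G expr0n/= invr0 !mulr0.
have J0 : J != 0 by rewrite -cn_gt0 cnJ.
rewrite /G /num !mulrA JJ mulN1r mulNr JJ opprK mul1r exprMn expr2 JJ.
have -> : - (J * z) = - J * z by rewrite mulNr.
rewrite mulN1r invrN mulrN -mulNr; congr (_ / _).
set a := f (J * z); set b := f (- z); set c := f (- J * z); set e := f z.
have -> : - (J * (a - J * b - c + J * e)) = - J * a + (J * J) * b + J * c - (J * J) * e by ring.
by rewrite JJ; ring.
Qed.

Let num_deriv z : cn z < r -> exists m, cderiv num z m.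
Proof.
move=> zr.
have h u : cn u = 1 -> exists m, cderiv (fun w => f (u * w)) z m.
  move=> u1; have [|m hm] := hol (z := u * z); first by rewrite cnM u1 mul1r.
  exists (u * m); have := @cderiv_affine R f 0 u z m; rewrite add0r => /(_ hm).
  by apply: (@cderiv_eq_near _ _ _ _ _ 1) => // w _; rewrite add0r.
have [m1 h1] := hol zr.
have [m2 h2] := h J cnJ.
have [|m3 h3] := h (-1); first by rewrite cnN cn1.
have [|m4 h4] := h (- J); first by rewrite cnN.
have := cderivD (cderivB (cderivB h1 (cderivZ J h2)) h3) (cderivZ J h4).
move=> h1234; eexists; apply: (cderiv_eq_near ltr01 _ h1234) => w _.
by rewrite /num mulN1r.
Qed.

Let G_deriv z : cn z < r -> z != 0 -> exists m, cderiv G z m.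
Proof.
move=> zr z0; have [m hm] := num_deriv zr.
have h2 := cderivM (cderiv_id z) (cderiv_id z).
have := cderivM hm (cderivV _ h2); rewrite mulf_neq0// => /(_ isT) h.
by eexists; apply: (cderiv_eq_near ltr01 _ h) => w _; rewrite /G expr2.
Qed.

Let E n (t : R) := sint G n (t%:C)%C (J * (t%:C)%C).

Let sintJ n a b : sint G n (J * a) (J * b) = sint G n a b.
Proof.
rewrite /sint savg_comp -mulrBr.
have -> : savg G n a b = savg (fun z => J * G (J * z)) n a b.
  by congr savg; apply/funext => z; rewrite G_rot.
by rewrite savgZ; ring.
Qed.

(** For z = x + i y the first condition reads x + y >= t: the half-plane beyond the line through t
    and J t. The region is convex, keeps away from 0, and contains the edges from s to J s for t <=
    s <= 2 t. *)
Let region (t : R) z := t <= complex.Re ((1 - J) * z) /\ cn (z - 0) <= 2 * t.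

Let region_closed t : mid_closed (region t).
Proof. exact: mid_closedI (mid_closed_halfplane _ _) (mid_closed_disc _ _). Qed.

Let cn1J : cn (1 - J) <= 2.
Proof. by have := cnD 1 (- J); rewrite cnN cnJ cn1; lra. Qed.

Let region_low t z : region t z -> t / 2 <= cn z.
Proof.
move=> [h _]; have := ReM_le (1 - J) z; have := cn_ge0 z; have := cn1J; nra.
Qed.

Let region_mem t s : 0 < t -> t <= s <= 2 * t ->
  region t (s%:C)%C /\ region t (J * (s%:C)%C).
Proof.
move=> t0 /andP[ts st]; have s0 : 0 < s by lra.
split; split.
- by rewrite /J/=; lra.
- by rewrite subr0 cn_real gtr0_norm.
- by rewrite /J/=; lra.
- by rewrite subr0 cnM cnJ mul1r cn_real gtr0_norm.
Qed.

(** The edges at t and t / 2 bound a trapezoid made of two triangles to which Goursat applies. Its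
    other two sides are exchanged by the quarter turn, under which the sums are invariant, and
    cancel. *)
Let E_half t : 0 < t -> t < r -> forall e, 0 < e ->
  exists N, forall n, (N <= n)%N -> cn (E n t - E n (t / 2)) <= e.
Proof.
move=> t0 tr e e0; have e2 : 0 < e / 2 by rewrite divr_gt0.
have t2 : 0 < t / 2 by rewrite divr_gt0.
have hG z : region (t / 2) z -> exists m, cderiv G z m.
  move=> hz; have low := region_low hz; case: hz => _; rewrite subr0 => hz.
  by apply: G_deriv; [lra|rewrite -cn_gt0; lra].
have [|Ra RJa] := @region_mem (t / 2) t t2; first by lra.
have [|Rb RJb] := @region_mem (t / 2) (t / 2) t2; first by lra.
have [N1 h1] := goursat (region_closed _) hG Ra RJa RJb e2.
have [N2 h2] := goursat (region_closed _) hG Ra RJb Rb e2.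
exists (maxn N1 N2) => n; rewrite geq_max => /andP[/h1 k1 /h2 k2].
rewrite /E; set a := (t%:C)%C in k1 k2 *; set b := ((t / 2)%:C)%C in k1 k2 *.
have -> : sint G n a (J * a) - sint G n b (J * b) =
    tsum G n a (J * a) (J * b) + tsum G n a (J * b) b.
  rewrite /tsum sintJ (sintC _ _ b a) (sintC _ _ a (J * b)) (sintC _ _ b (J * b)).
  by ring.
by apply: le_trans (cnD _ _) _; lra.
Qed.

Let E_shrink t k : 0 < t -> t < r -> forall e, 0 < e ->
  exists N, forall n, (N <= n)%N -> cn (E n t - E n (t / 2 ^+ k)) <= e.
Proof.
move=> t0 tr; elim: k => [|k IH] e e0.
  by exists 0%N => n _; rewrite expr0 divr1 subrr cn0 ltW.
have e2 : 0 < e / 2 by rewrite divr_gt0.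
have tk : t / 2 ^+ k <= t.
  by rewrite ler_pdivrMr ?exprn_gt0// ler_peMr ?exprn_ege1 ?ler1n// ltW.
have [N1 h1] := IH _ e2.
have [||N2 h2] := @E_half (t / 2 ^+ k) _ _ _ e2.
- by rewrite divr_gt0 ?exprn_gt0.
- exact: le_lt_trans tr.
exists (maxn N1 N2) => n; rewrite geq_max => /andP[/h1 k1 /h2 k2].
have -> : t / 2 ^+ k.+1 = t / 2 ^+ k / 2 by rewrite exprS invfM mulrA mulrAC.
by apply: le_trans (cn_tri (E n (t / 2 ^+ k)) _ _) _; lra.
Qed.

Let side t : 0 < t -> cn (J * (t%:C)%C - (t%:C)%C) <= 2 * t.
Proof.
move=> t0; have := cnD (J * (t%:C)%C) (- (t%:C)%C).
by rewrite cnN cnM cnJ mul1r cn_real gtr0_norm//; lra.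
Qed.

Let E_upper t n : 0 < t -> 2 * t < r -> cn (E n t) <= 32 * M / t.
Proof.
move=> t0 tr.
have [|Ra RJa] := @region_mem t t t0; first by lra.
have M0 : 0 <= M.
  by apply: le_trans (cn_ge0 (f 0)) (bnd _); rewrite cn0; lra.
have h : cn (savg G n (t%:C)%C (J * (t%:C)%C)) <= 16 * M / t ^+ 2.
  rewrite -[savg _ _ _ _]subr0.
  apply: (@savg_mid_ind _ (region t) (fun z => cn (z - 0) <= 16 * M / t ^+ 2)) => //.
  - exact: (region_closed t).1.
  - by move=> x y; apply: cn_mid_le.
  move=> z hz; have low := region_low hz; case: hz => _; rewrite !subr0 => hz.
  have zr : cn z < r by lra.
  have numM : cn (num z) <= 4 * M.
    rewrite /num; set a := f _; set b := f (J * z); set d := f (- z); set k := f (- J * z).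
    have ha : cn a <= M by apply: bnd.
    have hb : cn b <= M by apply: bnd; rewrite cnM cnJ mul1r.
    have hd : cn d <= M by apply: bnd; rewrite cnN.
    have hk : cn k <= M by apply: bnd; rewrite cnM cnN cnJ mul1r.
    have := cnD (a - J * b - d) (J * k); have := cnD (a - J * b) (- d).
    by have := cnD a (- (J * b)); rewrite !cnN !cnM !cnJ !mul1r; lra.
  rewrite /G cnM cnV cnX ler_pdivrMr ?exprn_gt0//; last by lra.
  rewrite mulrAC ler_pdivlMr ?exprn_gt0//.
  have k : t ^+ 2 <= 4 * cn z ^+ 2 by rewrite !expr2; nra.
  have := ler_pM (cn_ge0 (num z)) (sqr_ge0 t) numM k; lra.
rewrite /E /sint cnM; apply: le_trans (ler_pM (cn_ge0 _) (cn_ge0 _) (side t0) h) _.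
rewrite le_eqVlt; apply/orP; left; apply/eqP; field.
by rewrite gt_eqF.
Qed.

(** The integral itself is i pi / 2, but a pointwise bound suffices at every level: on the edge, the
    imaginary part of (J t - t) / z is t (x + y) / |z|^2, which is at least 1 because x + y >= t and
    |z| <= t. *)
Let winding t n : 0 < t ->
  1 <= cn (sint (fun z => z^-1) n (t%:C)%C (J * (t%:C)%C)).
Proof.
move=> t0; apply: le_trans (Im_le_cn _); apply: le_trans (ler_norm _).
have [|Ra RJa] := @region_mem t t t0; first by lra.
pose B z := t <= complex.Re ((1 - J) * z) /\ cn (z - 0) <= t.
have Bc : mid_closed B by exact: mid_closedI (mid_closed_halfplane _ _) (mid_closed_disc _ _).
rewrite /sint -savgZ.
apply: (@savg_mid_ind _ B (fun z => 1 <= complex.Im z)).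
- exact: Bc.1.
- move=> x y hx hy; have -> : complex.Im (mid x y) = (complex.Im x + complex.Im y) / 2.
    rewrite /mid; have -> : (2 : R[i])^-1 = (2^-1 : R)%:C%C by rewrite fmorphV rmorph_nat.
    by case: x y {hx hy} => [? ?] [? ?] /=; rewrite mulr0 add0r.
  by lra.
- case=> x y []; rewrite subr0 /J/= => h1 h2.
  have q : x ^+ 2 + y ^+ 2 <= t ^+ 2.
    rewrite -(@ler_sqrt _ _ _ (sqr_ge0 t)) sqrtr_sqr gtr0_norm//.
  have xy : t <= x + y by lra.
  have q0 : 0 < x ^+ 2 + y ^+ 2.
    have t2 : 0 < t * t by rewrite mulr_gt0.
    have tt : t * t <= (x + y) * (x + y) by rewrite ler_pM// ltW.
    by have := sqr_ge0 (x - y); move: t2 tt; rewrite !expr2; lra.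
  rewrite -mulrN -(mulrC t) [X in _ <= X](_ : _ = t * (x + y) / (x ^+ 2 + y ^+ 2)).
    rewrite ler_pdivlMr// mul1r; apply: le_trans q _; rewrite expr2 ler_pM2l//; lra.
  by field; rewrite gt_eqF.
- by split; [exact: Ra.1|rewrite subr0 cn_real gtr0_norm].
- by split; [exact: RJa.1|rewrite subr0 cnM cnJ mul1r cn_real gtr0_norm].
Qed.

(** Near 0, [num z] is 4 l z up to o(z), so on a tiny edge [E] is close to 4 l times the sum of 1 /
    z, of modulus at least 4 |l|. Moving the edge out to t = r / 4 hardly changes [E], and there |E|
    <= 32 M / t. *)
Lemma cauchy_estimate0 : 0 < r -> cn l <= 32 * M / r.
Proof.
move=> r0; pose t := r / 4; have t0 : 0 < t by rewrite divr_gt0.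
have tr : 2 * t < r by rewrite /t; lra.
(* 16 e comes from replacing [G] by 4 l / z on the tiny edge ([EW]), one more e from moving the edge
   ([E_shrink]). *)
suff h e : 0 < e -> 4 * cn l <= 32 * M / t + 17 * e.
  have : 4 * cn l <= 32 * M / t.
    apply/ler_addgt0Pr => e e0; have e17 : 0 < e / 17 by rewrite divr_gt0.
    by have := h _ e17; lra.
  have -> : 32 * M / t = 4 * (32 * M / r) by rewrite /t; field; rewrite gt_eqF.
  by rewrite ler_pM2l.
move=> e0; have [d d0 hd] := f0 e0.
have [k hk] := @geometric_lt _ (2 * t) _ d0.
have t'0 : 0 < t / 2 ^+ k by rewrite divr_gt0 ?exprn_gt0.
have tk : t / 2 ^+ k <= t.
  by rewrite ler_pdivrMr ?exprn_gt0// ler_peMr ?exprn_ege1 ?ler1n// ltW.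
have [|N hN] := @E_shrink t k t0 _ _ e0; first by lra.
have {hN} hN := hN _ (leqnn N).
have up := E_upper N t0 tr; have wind := winding N t'0.
move: hk tk t'0 hN wind; rewrite -mulrA; move: (t / 2 ^+ k) => u hu ut u0 hN wind.
have [|Ra RJa] := @region_mem u u u0; first by lra.
have app : cn (savg G N (u%:C)%C (J * (u%:C)%C) -
    savg (fun z => 4 * l * z^-1) N (u%:C)%C (J * (u%:C)%C)) <= 8 * e / u.
  apply: (@savg_close (region u)) => //; first exact: (region_closed u).1.
  move=> z hz; have low := region_low hz; case: hz => _; rewrite subr0 => hz.
  have cz0 : 0 < cn z by lra.
  have z0 : z != 0 by rewrite -cn_gt0.
  have err v : cn v = cn z -> cn (f v - f 0 - l * v) <= e * cn z.
    by move=> vz; have := hd v; rewrite subr0 vz; apply; lra.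
  have -> : G z - 4 * l * z^-1 = (num z - 4 * l * z) / z ^+ 2 by rewrite /G; field.
  rewrite cnM cnV cnX ler_pdivrMr ?exprn_gt0// [leRHS]mulrAC ler_pdivlMr//.
  have numE : num z - 4 * l * z = (f z - f 0 - l * z)
      - J * (f (J * z) - f 0 - l * (J * z)) - (f (- z) - f 0 - l * - z)
      + J * (f (- J * z) - f 0 - l * (- J * z)).
    have -> : 4 * l * z = 2 * l * z - 2 * (J * J) * l * z by rewrite JJ; ring.
    by rewrite /num; ring.
  have c1 := err z erefl.
  have c2 : cn (f (J * z) - f 0 - l * (J * z)) <= e * cn z.
    by apply: err; rewrite cnM cnJ mul1r.
  have c3 : cn (f (- z) - f 0 - l * - z) <= e * cn z by apply: err; rewrite cnN.
  have c4 : cn (f (- J * z) - f 0 - l * (- J * z)) <= e * cn z.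
    by apply: err; rewrite cnM cnN cnJ mul1r.
  have numB : cn (num z - 4 * l * z) <= 4 * e * cn z.
    move: c1 c2 c3 c4; rewrite numE.
    move: (f z - _ - _) (f (J * z) - _ - _) (f (- z) - _ - _) (f (- J * z) - _ - _).
    move=> x1 x2 x3 x4 c1 c2 c3 c4.
    have := cnD (x1 - J * x2 - x3) (J * x4); have := cnD (x1 - J * x2) (- x3).
    by have := cnD x1 (- (J * x2)); rewrite !cnN !cnM !cnJ !mul1r; lra.
  have k1 : cn (num z - 4 * l * z) * u <= 4 * e * cn z * (2 * cn z).
    by apply: ler_pM; [exact: cn_ge0|exact: ltW|exact: numB|lra].
  by move: k1; rewrite expr2; lra.
pose W := sint (fun z => z^-1) N (u%:C)%C (J * (u%:C)%C).
have EW : cn (E N u - 4 * l * W) <= 16 * e.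
  have -> : E N u - 4 * l * W = (J * (u%:C)%C - (u%:C)%C) *
     (savg G N (u%:C)%C (J * (u%:C)%C) -
      savg (fun z => 4 * l * z^-1) N (u%:C)%C (J * (u%:C)%C)).
    by rewrite savgZ /E /W /sint; ring.
  rewrite cnM; apply: le_trans (ler_pM (cn_ge0 _) (cn_ge0 _) (side u0) app) _.
  have -> : 2 * u * (8 * e / u) = 16 * e by field; rewrite gt_eqF.
  by [].
have l4 : cn (4 * l * W) = 4 * cn l * cn W by rewrite !cnM cn_nat.
have l5 : 4 * cn l <= 4 * cn l * cn W by rewrite ler_peMr// mulr_ge0 ?cn_ge0.
have := cnDB (4 * l * W) (E N u); rewrite (cnB _ (E N u)) l4.
by have := cnDB (E N u) (E N t); rewrite (cnB (E N u)); lra.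
Qed.

End CauchyEstimate.

(** * Regularity of holomorphic functions of one variable *)

Section HolomorphicDisc.
Variable R : realType.
Implicit Types (a b c p u v z w l m : R[i]) (e d s r M D : R).
Implicit Types (f g : R[i] -> R[i]).

Definition hol_disc f c r := forall z, cn (z - c) < r -> exists l, cderiv f z l.

Lemma cauchy_estimate f c r M l : 0 < r -> hol_disc f c r ->
  (forall z, cn (z - c) < r -> cn (f z) <= M) -> cderiv f c l ->
  cn l <= 32 * M / r.
Proof.
move=> r0 hf fM fl.
apply: (@cauchy_estimate0 R (fun z => f (c + 1 * z))) => //.
- move=> z zr; have [|m hm] := hf (c + 1 * z); first by rewrite mul1r addrC addKr.
  by exists (1 * m); apply: cderiv_affine.
- by move=> z zr; apply: fM; rewrite mul1r addrC addKr.
- by rewrite -[l]mul1r; apply: cderiv_affine; rewrite mulr0 addr0.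
Qed.

(** Bisection of the degenerate triangle [a b b], two of whose parts are the halves of the segment;
    the bound M |b - a| + e1 s adds up over them. *)
Lemma mean_value_ineq f g c r M :
  (forall z, cn (z - c) < r -> cderiv f z (g z)) ->
  (forall z, cn (z - c) < r -> cn (g z) <= M) ->
  forall a b, cn (a - c) < r -> cn (b - c) < r ->
  cn (f b - f a) <= M * cn (b - a).
Proof.
move=> fg gM a b ar br.
have [->|ab] := eqVneq a b; first by rewrite !subrr cn0 mulr0.
have ab0 : 0 < cn (b - a) by rewrite cn_gt0 subr_eq0 eq_sym.
apply/ler_addgt0Pr => e e0.
(* Bisection needs a closed set: a closed disc inside the open one that contains both end points. *)
pose t := Num.max (cn (a - c)) (cn (b - c)).
have tr : t < r by rewrite gt_max ar.
have e' : 0 < e / (3 * cn (b - a)) by rewrite divr_gt0// mulr_gt0.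
set e1 := e / _ in e'.
pose P s a b (_ : R[i]) := cn (f b - f a) <= M * cn (b - a) + e1 * s.
suff : P (3 * cn (b - a)) a b b by rewrite /P /e1 divfK// gt_eqF// mulr_gt0.
apply: (@triangle_bisection R (fun z => cn (z - c) <= t) P) => //.
- exact: mid_closed_disc.
- move=> s x y z s0 _ _ _ p1 p2 _ _; rewrite /P in p1 p2 *.
  have := cn_tri (f (mid x y)) (f y) (f x).
  have mx : cn (mid x y - x) = cn (y - x) / 2 by rewrite cn_mid_dist.
  have my : cn (y - mid x y) = cn (y - x) / 2.
    by rewrite (cnB y (mid x y)) (cnB y x) midC; apply: cn_mid_dist.
  by move: p1 p2; rewrite mx my; lra.
- move=> p pt; have e2 : 0 < e1 / 2 by rewrite divr_gt0.
  have pr : cn (p - c) < r by lra.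
  have fgp := fg p pr; have [d d0 hd] := fgp _ e2.
  exists d => // s x y z s0 sd _ _ _ xp yp _; rewrite /P.
  have kx := hd x (le_lt_trans xp sd); have ky := hd y (le_lt_trans yp sd).
  have -> : f y - f x = (f y - f p - g p * (y - p)) - (f x - f p - g p * (x - p))
     + g p * (y - x) by ring.
  have := cnD (f y - f p - g p * (y - p)) (- (f x - f p - g p * (x - p))).
  rewrite cnN; set u := f y - _ - _; set v := f x - _ - _ in kx * => huv.
  have := cnD (u - v) (g p * (y - x)); rewrite cnM => h.
  have k1 : cn (g p) * cn (y - x) <= M * cn (y - x) by rewrite ler_wpM2r ?cn_ge0// gM.
  have k2 : e1 / 2 * cn (x - p) <= e1 / 2 * s by rewrite ler_wpM2l// ltW.
  have k3 : e1 / 2 * cn (y - p) <= e1 / 2 * s by rewrite ler_wpM2l// ltW.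
  by move: h huv; rewrite -/u in ky; lra.
- by rewrite mulr_gt0.
- by rewrite le_max lexx.
- by rewrite le_max lexx orbT.
- by rewrite le_max lexx orbT.
- by rewrite mulrAC divff ?mul1r// pnatr_eq0.
- by rewrite subrr cn0 divr_ge0// mulr_ge0// cn_ge0.
- by rewrite mulrAC divff ?mul1r// pnatr_eq0.
Qed.

Lemma cderiv_shift f z w l : cderiv f (z + w) l -> cderiv (fun t => f (t + w)) z l.
Proof.
move=> h; rewrite -[l]mul1r; have := @cderiv_affine R f w 1 z l.
rewrite mul1r addrC => /(_ h); rewrite mul1r.
by apply: (@cderiv_eq_near _ _ _ _ _ 1) => // t _; rewrite mul1r addrC.
Qed.

(** Cauchy's estimate, applied three times, replaces an integral formula. For [f] it bounds [g]; for
    f(t + h) - f(t), which is then O(h), it makes [g] Lipschitz, whence a Taylor remainder of order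
    h^2. So the difference of two quotients of [f] with steps h and h' is O(|h| + |h'|), and a last
    estimate carries this bound to its derivative: the quotients of [g] are Cauchy. *)
Lemma cderiv_deriv f g c r : (forall z, cn (z - c) < r -> cderiv f z (g z)) ->
  hol_disc g c r.
Proof.
move=> fg z0 z0r.
have [d d0 hd] := cderiv_cont (fg z0 z0r) ltr01.
pose M := cn (f z0) + 1; have M0 : 0 < M by rewrite /M ltr_wpDl ?cn_ge0.
pose q := Num.min d (r - cn (z0 - c)) / 4.
have q0 : 0 < q by rewrite divr_gt0// lt_min d0 subr_gt0.
have q4 : 4 * q = Num.min d (r - cn (z0 - c)) by rewrite /q; field.
have qd : 4 * q <= d by rewrite q4 ge_min lexx.
have qr : 4 * q <= r - cn (z0 - c) by rewrite q4 ge_min lexx orbT.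
have fgq z : cn (z - z0) < 4 * q -> cderiv f z (g z).
  by move=> hz; apply: fg; have := cn_tri z0 z c; lra.
have fM z : cn (z - z0) < 4 * q -> cn (f z) <= M.
  move=> hz; have := hd z (lt_le_trans hz qd).
  by have := cnDB (f z) (f z0); rewrite /M; lra.
have tri z h s t : cn (z - z0) <= s -> cn h < t -> cn (z + h - z0) < s + t.
  move=> h1 h2; have := cnD (z - z0) h.
  have -> : z - z0 + h = z + h - z0 by ring.
  by lra.
pose M1 := 32 * M / q; have M10 : 0 < M1 by rewrite divr_gt0// mulr_gt0.
have gM1 z : cn (z - z0) < 3 * q -> cn (g z) <= M1.
  move=> hz; apply: (@cauchy_estimate f z q) => //.
  - by move=> w hw; exists (g w); apply: fgq; have := cn_tri z w z0; lra.
  - by move=> w hw; apply: fM; have := cn_tri z w z0; lra.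
  - by apply: fgq; lra.
pose M2 := 32 * M1 / q; have M20 : 0 < M2 by rewrite divr_gt0// mulr_gt0.
have gM2 z h : cn (z - z0) < q -> cn h < q -> cn (g (z + h) - g z) <= M2 * cn h.
  move=> hz hh.
  have -> : M2 * cn h = 32 * (M1 * cn h) / q by rewrite /M2; field; rewrite gt_eqF.
  have fd w : cn (w - z) < q -> cderiv (fun t => f (t + h) - f t) w (g (w + h) - g w).
    move=> hw; have := cn_tri z w z0 => k.
    have wz : cn (w - z0) <= 2 * q by lra.
    apply: cderivB; last by apply: fgq; lra.
    by apply: cderiv_shift; apply: fgq; have := tri w h _ _ wz hh; lra.
  apply: (@cauchy_estimate (fun t => f (t + h) - f t) z q) => //.
  - by move=> w hw; exists (g (w + h) - g w); apply: fd.
  - move=> w hw; have k := cn_tri z w z0.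
    have wz : cn (w - z0) <= 2 * q by lra.
    have -> : M1 * cn h = M1 * cn (w + h - w) by rewrite addrAC subrr add0r.
    apply: (@mean_value_ineq f g z0 (3 * q)) => //.
    + by move=> x hx; apply: fgq; lra.
    + by lra.
    + by have := tri w h _ _ wz hh; lra.
  - by apply: fd; rewrite subrr cn0.
have taylor z h : cn (z - z0) < q -> cn h < q ->
    cn (f (z + h) - f z - g z * h) <= M2 * cn h * cn h.
  move=> hz hh; pose k t := f (z + t) - g z * t.
  have -> : f (z + h) - f z - g z * h = k h - k 0 by rewrite /k mulr0 subr0 addr0 addrAC.
  have -> : M2 * cn h * cn h = M2 * cn h * cn (h - 0) by rewrite subr0.
  apply/ler_addgt0Pr => e e0.
  have [h0|h0] := eqVneq h 0.
    by rewrite h0 !subrr cn0 mulr0 add0r ltW.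
  have hp : 0 < cn h by rewrite cn_gt0.
  (* Slack that puts [h] inside an open disc still contained in the disc of radius [q]; its cost is
     at most e. *)
  pose e' := Num.min (e / (M2 * cn h)) (q - cn h).
  have e'0 : 0 < e' by rewrite lt_min subr_gt0 hh divr_gt0// mulr_gt0.
  have e'1 : e' * (M2 * cn h) <= e.
    have k1 : e' <= e / (M2 * cn h) by rewrite /e' ge_min lexx.
    by move: k1; rewrite ler_pdivlMr// mulr_gt0.
  have e'2 : cn h + e' <= q.
    have k1 : e' <= q - cn h by rewrite /e' ge_min lexx orbT.
    by lra.
  have kder t : cn (t - 0) < cn h + e' -> cderiv k t (g (z + t) - g z).
    rewrite subr0 => ht; apply: cderivB.
      have := @cderiv_affine R f z 1 t (g (z + t)); rewrite !mul1r => H.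
      apply: (cderiv_eq_near ltr01 _ (H _)); first by move=> w _; rewrite mul1r.
      by apply: fgq; have := tri z t q q (ltW hz) (lt_le_trans ht e'2); lra.
    by have := cderivZ (g z) (cderiv_id t); rewrite mulr1.
  have hb t : cn (t - 0) < cn h + e' -> cn (g (z + t) - g z) <= M2 * (cn h + e').
    rewrite subr0 => ht; apply: le_trans (gM2 z t hz (lt_le_trans ht e'2)) _.
    by rewrite ler_wpM2l// ltW.
  have h1 : cn (0 - 0 : R[i]) < cn h + e' by rewrite subrr cn0; lra.
  have h2 : cn (h - 0) < cn h + e' by rewrite subr0; lra.
  apply: le_trans (mean_value_ineq kder hb h1 h2) _.
  by move: e'1; rewrite subr0; lra.
pose M3 := 32 * M2 / q; have M30 : 0 < M3 by rewrite divr_gt0// mulr_gt0.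
pose L h := (g (z0 + h) - g z0) / h.
have LL h h' : h != 0 -> h' != 0 -> cn h < q -> cn h' < q ->
    cn (L h - L h') <= M3 * (cn h + cn h').
  move=> h0 h'0 hq h'q.
  have -> : M3 * (cn h + cn h') = 32 * (M2 * (cn h + cn h')) / q.
    by rewrite /M3; field; rewrite gt_eqF.
  (* The terms [g z] cancel in the difference, so the Taylor remainders bound [Q] without any
     knowledge of the derivative of [g]. *)
  pose Q z := h^-1 * (f (z + h) - f z) - h'^-1 * (f (z + h') - f z).
  have Qd z : cn (z - z0) < q -> cderiv Q z
      (h^-1 * (g (z + h) - g z) - h'^-1 * (g (z + h') - g z)).
    move=> hz; apply: cderivB; apply: cderivZ; apply: cderivB;
      try (by apply: fgq; lra); apply: cderiv_shift; apply: fgq.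
      by have := tri z h _ _ (ltW hz) hq; lra.
    by have := tri z h' _ _ (ltW hz) h'q; lra.
  apply: (@cauchy_estimate Q z0 q) => //.
  - by move=> z hz; eexists; apply: Qd.
  - move=> z hz.
    have -> : Q z = h^-1 * (f (z + h) - f z - g z * h) - h'^-1 * (f (z + h') - f z - g z * h').
      by rewrite /Q; field; rewrite h0 h'0.
    have half x : x != 0 -> cn x < q -> cn (x^-1 * (f (z + x) - f z - g z * x)) <= M2 * cn x.
      move=> x0 xq; rewrite cnM cnV ler_pdivrMl ?cn_gt0//.
      by have := taylor z x hz xq; lra.
    have := cnD (h^-1 * (f (z + h) - f z - g z * h)) (- (h'^-1 * (f (z + h') - f z - g z * h'))).
    by rewrite cnN; have := half h h0 hq; have := half h' h'0 h'q; lra.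
  - have -> : L h - L h' = h^-1 * (g (z0 + h) - g z0) - h'^-1 * (g (z0 + h') - g z0).
      by rewrite /L ![_^-1 * _]mulrC.
    by apply: Qd; rewrite subrr cn0.
pose h_ n : R[i] := ((q / 4 / 2 ^+ n)%:C)%C.
have hpos n : 0 < q / 4 / 2 ^+ n.
  by apply: divr_gt0; [exact: divr_gt0|exact: exprn_gt0].
have hn n : cn (h_ n) = q / 4 / 2 ^+ n.
  by rewrite cn_real gtr0_norm.
have hn0 n : h_ n != 0 by rewrite -cn_gt0 hn.
have hnq n : cn (h_ n) < q.
  rewrite hn ltr_pdivrMr ?exprn_gt0//.
  have : 1 <= (2 : R) ^+ n by rewrite exprn_ege1// ler1n.
  by move: (2 ^+ n) => x x1; nra.
have [n|p hp] := @fast_cauchy R (fun n => L (h_ n)) (M3 * q / 2).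
  apply: le_trans (LL _ _ (hn0 _) (hn0 _) (hnq _) (hnq _)) _.
  rewrite !hn exprS invfM; have : 0 < (2 : R) ^- n by rewrite invr_gt0 exprn_gt0.
  move: (2 ^- n) => x x0; have := mulr_gt0 (mulr_gt0 M30 q0) x0.
  by lra.
have Lp h : h != 0 -> cn h < q -> cn (L h - p) <= M3 * cn h.
  move=> h0 hq; apply/ler_addgt0Pr => e e0.
  have [n hlt] := @geometric_lt R (M3 * q * 3) _ e0.
  have := cn_tri (L (h_ n)) (L h) p; have := LL _ _ h0 (hn0 n) hq (hnq n).
  have := hp n; rewrite hn; move: hlt; move: (2 ^- n) => x.
  have := cn_ge0 (L h - p); lra.
exists p => e e0; exists (Num.min q (e / M3)) => [|w]; first by rewrite lt_min q0 divr_gt0.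
rewrite lt_min => /andP[w1 w2].
have [->|wz] := eqVneq w z0; first by rewrite !subrr mulr0 subrr cn0 mulr0.
have h0 : w - z0 != 0 by rewrite subr_eq0.
have -> : g w - g z0 - p * (w - z0) = (L (w - z0) - p) * (w - z0).
  have zw : z0 + (w - z0) = w by ring.
  by rewrite /L zw; field.
rewrite cnM ler_wpM2r ?cn_ge0//; apply: le_trans (Lp _ h0 w1) _.
by move: w2; rewrite ltr_pdivlMr// => w2; lra.
Qed.

(** All successive derivatives are carried as data, so that estimates of order k make no choice of
    derivatives. *)
Definition deriv_chain (F : nat -> R[i] -> R[i]) c r :=
  forall j z, cn (z - c) < r -> cderiv (F j) z (F j.+1 z).

Lemma cauchy_estimate_iter k : exists2 C, 0 < C & forall F c r M, 0 < r ->
  deriv_chain F c r -> (forall z, cn (z - c) < r -> cn (F 0%N z) <= M) ->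
  cn (F k c) <= C * M / r ^+ k.
Proof.
elim: k => [|k [C C0 IH]].
  exists 1 => // F c r M r0 _ h; rewrite expr0 mul1r divr1; apply: h.
  by rewrite subrr cn0.
exists (C * 64 * 2 ^+ k) => [|F c r M r0 hF h]; first by rewrite !mulr_gt0 ?exprn_gt0.
have -> : C * 64 * 2 ^+ k * M / r ^+ k.+1 = C * (64 * M / r) / (r / 2) ^+ k.
  rewrite exprS expr_div_n; have : r ^+ k != 0 by rewrite expf_neq0 ?gt_eqF.
  have : (2 : R) ^+ k != 0 by rewrite expf_neq0 ?pnatr_eq0.
  move: (r ^+ k) (2 ^+ k) => x y y0 x0; field.
  by rewrite y0 x0 gt_eqF.
apply: (IH (fun j => F j.+1)); first by rewrite divr_gt0.
  by move=> j z hz; apply: hF; lra.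
move=> z hz; have -> : 64 * M / r = 32 * M / (r / 2) by field; rewrite gt_eqF.
have r2 : 0 < r / 2 by rewrite divr_gt0.
apply: (@cauchy_estimate (F 0%N) z (r / 2)) => //.
- move=> w hw; exists (F 1%N w); apply: hF; have := cn_tri z w c; lra.
- by move=> w hw; apply: h; have := cn_tri z w c; lra.
- by apply: hF; lra.
Qed.

End HolomorphicDisc.

(** * Primitives and the Borel-Caratheodory bound *)

Section Primitive.
Variable R : realType.
Implicit Types (a b c p u v z w l : R[i]) (e d s r M D : R).
Implicit Types (f g : R[i] -> R[i]).

Lemma cauchy_complete (x : nat -> R[i]) :
  (forall e, 0 < e -> exists N, forall n m, (N <= n)%N -> (N <= m)%N ->
     cn (x n - x m) <= e) ->
  exists p, forall e, 0 < e -> exists N, forall n, (N <= n)%N -> cn (x n - p) <= e.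
Proof.
move=> hx.
have NN k : {N | forall n m, (N <= n)%N -> (N <= m)%N -> cn (x n - x m) <= 1 / 2 ^+ k}.
  by apply/cid/hx; rewrite divr_gt0 ?exprn_gt0.
(* Summing the thresholds makes them monotone, which yields a rapidly converging subsequence. *)
pose N' k := (\sum_(j < k.+1) sval (NN j))%N.
have NN' k : (sval (NN k) <= N' k)%N by rewrite /N' big_ord_recr/= leq_addl.
have N'S k : (N' k <= N' k.+1)%N by rewrite /N' [leqRHS]big_ord_recr/= leq_addr.
have [|p hp] := @fast_cauchy R (fun k => x (N' k)) 1.
  by move=> k; apply: (svalP (NN k)); [apply: leq_trans (N'S k)|].
exists p => e e0; have [k hk] := @geometric_lt R 5 _ e0.
exists (N' k) => n hn.
have := svalP (NN k) n (N' k) (leq_trans (NN' k) hn) (NN' k).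
have := cn_tri (x (N' k)) (x n) p; have := hp k; move: hk.
by move: (2 ^- k) => y; lra.
Qed.

(** On short segments near p every level is close to f(p) (b - a), by continuity; since levels split
    additively, bisection carries the agreement to the whole segment. *)
Lemma sint_cauchy f c r a b : hol_disc f c r -> cn (a - c) < r -> cn (b - c) < r ->
  forall e, 0 < e -> exists N, forall n m, (N <= n)%N -> (N <= m)%N ->
    cn (sint f n a b - sint f m a b) <= e.
Proof.
move=> hf ar br e e0.
pose t := Num.max (cn (a - c)) (cn (b - c)).
have tr : t < r by rewrite gt_max ar.
pose s := 3 * cn (b - a) + 1.
have ab0 := cn_ge0 (b - a); have s0 : 0 < s by rewrite /s; lra.
pose e1 := e / s; have e10 : 0 < e1 by rewrite divr_gt0.
pose P s a b (_ : R[i]) := exists N, forall n m, (N <= n)%N -> (N <= m)%N ->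
    cn (sint f n a b - sint f m a b) <= e1 * s.
suff : P s a b b by rewrite /P /e1 divfK// gt_eqF.
apply: (@triangle_bisection R (fun z => cn (z - c) <= t) P) => //.
- exact: mid_closed_disc.
- move=> {s0 e10} u x y z u0 _ _ _ [N1 h1] [N2 h2] _ _.
  exists (maxn N1 N2).+1 => -[//|n] [//|m]; rewrite !ltnS !geq_max.
  move=> /andP[n1 n2] /andP[m1 m2]; rewrite !sintS.
  have := h1 _ _ n1 m1; have := h2 _ _ n2 m2.
  set x1 := sint f n x _; set x2 := sint f n _ y.
  set y1 := sint f m x _; set y2 := sint f m _ y.
  have -> : x1 + x2 - (y1 + y2) = (x1 - y1) + (x2 - y2) by ring.
  by have := cnD (x1 - y1) (x2 - y2); lra.
- move=> p pt; have e4 : 0 < e1 / 4 by rewrite divr_gt0.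
  have [|l fp] := hf p; first by lra.
  have [d d0 hd] := cderiv_cont fp e4.
  exists d => // u x y z u0 ud _ _ _ xp yp _; exists 0%N => n m _ _.
  have app w : cn (w - p) <= u -> cn (f w - (f p + 0 * w)) <= e1 / 4.
    by move=> wp; rewrite mul0r addr0 hd// (le_lt_trans wp).
  have hn := sint_affine n app xp yp; have hm := sint_affine m app xp yp.
  move: hn hm; set Q := (y - x) * _ => hn hm.
  have := cn_tri Q (sint f n x y) (sint f m x y); rewrite (cnB Q).
  have xy : cn (y - x) <= 2 * u by have := cn_tri p y x; rewrite (cnB p); lra.
  have : e1 / 4 * cn (y - x) <= e1 / 4 * (2 * u) by rewrite ler_wpM2l// ltW.
  by lra.
- by rewrite le_max lexx.
- by rewrite le_max lexx orbT.
- by rewrite le_max lexx orbT.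
- by rewrite /s; lra.
- by rewrite subrr cn0; lra.
- by rewrite /s; lra.
Qed.

(** The primitive is the limit of the sums from the centre. Goursat on the triangle [c], [z], [w]
    reduces its increment to the segment from [z] to [w], on which [f] is close to [f z]. *)
Lemma primitive_disc f c r : hol_disc f c r ->
  exists g, forall z, cn (z - c) < r -> cderiv g z (f z).
Proof.
move=> hf.
have lim z : {p | cn (z - c) < r -> forall e, 0 < e ->
    exists N, forall n, (N <= n)%N -> cn (sint f n c z - p) <= e}.
  apply: cid; have [zr|nzr] := pselect (cn (z - c) < r); last by exists 0.
  have r0 : cn (c - c) < r by rewrite subrr cn0; apply: le_lt_trans zr; apply: cn_ge0.
  by have [p hp] := cauchy_complete (sint_cauchy hf r0 zr); exists p.
exists (fun z => sval (lim z)) => z zr e e0.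
have [l fl] := hf z zr; have [d d0 hd] := cderiv_cont fl e0.
exists (Num.min d (r - cn (z - c))) => [|w]; first by rewrite lt_min d0 subr_gt0.
rewrite lt_min => /andP[wd wr].
have wr' : cn (w - c) < r by have := cn_tri z w c; lra.
apply/ler_addgt0Pr => k k0; have k3 : 0 < k / 3 by rewrite divr_gt0.
have [N1 h1] := svalP (lim z) zr _ k3; have [N2 h2] := svalP (lim w) wr' _ k3.
pose t := Num.max (cn (z - c)) (cn (w - c)).
have tr : t < r by rewrite gt_max zr.
have [|||||N3 h3] := @goursat R (fun x => cn (x - c) <= t) f c z w _ _ _ _ _ _ k3.
- exact: mid_closed_disc.
- by move=> x xt; apply: hf; lra.
- by rewrite subrr cn0 le_max cn_ge0.
- by rewrite le_max lexx.
- by rewrite le_max lexx orbT.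
pose n := maxn N1 (maxn N2 N3).
have := h1 n; rewrite leq_maxl => /(_ isT) k1.
have := h2 n; rewrite leq_max leq_maxl orbT => /(_ isT) k2.
have := h3 n; rewrite leq_max leq_maxr orbT => /(_ isT) {}k3.
move: k1 k2 k3; set p := sval _; set q := sval _.
rewrite /tsum (sintC _ _ c w); set X := sint f n c z; set Y := sint f n c w.
set Z := sint f n z w => k1 k2 k4.
have app x : cn (x - z) <= cn (w - z) -> cn (f x - (f z + 0 * x)) <= e.
  by move=> xz; rewrite mul0r addr0; apply: hd; lra.
have zz : cn (z - z) <= cn (w - z) by rewrite subrr cn0 cn_ge0.
have := sint_affine n app zz (lexx _); rewrite mul0r addr0 -/Z => k5.
have -> : q - p - f z * (w - z) = (X - p) - (Y - q) - (X + Z - Y) + (Z - (w - z) * f z).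
  by ring.
have := cnD (X - p - (Y - q) - (X + Z - Y)) (Z - (w - z) * f z).
have := cnD (X - p - (Y - q)) (- (X + Z - Y)).
have := cnD (X - p) (- (Y - q)).
by rewrite !cnN; lra.
Qed.

End Primitive.

Section LogHarnack.
Variable R : realType.
Implicit Types (a b c p u v z w l m : R[i]) (e d s r M D A : R).
Implicit Types (f g : R[i] -> R[i]).

Lemma sqr_cn z : cn z ^+ 2 = complex.Re z ^+ 2 + complex.Im z ^+ 2.
Proof. by case: z => x y; rewrite sqr_sqrtr// addr_ge0 ?sqr_ge0. Qed.

(** Here |1 + z|^2 = 1 + x with x = 2 Re z + |z|^2, and ln (1 + x) lies between x / (1 + x) and x.
    Only real logarithms of moduli are used. *)
Lemma ln_cn1D z : cn z <= 2^-1 ->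
  `|ln (cn (1 + z)) - complex.Re z| <= 13 * cn z ^+ 2.
Proof.
move=> z2; have z0 := cn_ge0 z.
have lo : 2^-1 <= cn (1 + z).
  by have := cnD (1 + z) (- z); rewrite addrK cnN cn1; lra.
set x := 2 * complex.Re z + cn z ^+ 2.
have xE : cn (1 + z) ^+ 2 = 1 + x.
  rewrite /x !sqr_cn !raddfD/=; ring.
have x1 : 4^-1 <= 1 + x by rewrite -xE expr2; nra.
have lnE : 2 * ln (cn (1 + z)) = ln (1 + x).
  have c0 : 0 < cn (1 + z) by lra.
  by rewrite -xE lnXn// mulr_natl.
have x10 : 0 < 1 + x by lra.
have up : ln (1 + x) <= x by have := @le_ln1Dx R x; apply; lra.
have low : x / (1 + x) <= ln (1 + x).
  have h : -1 < (1 + x)^-1 - 1 by rewrite ltrBrDl addrN invr_gt0.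
  have := le_ln1Dx h; rewrite addrC subrK lnV ?posrE//.
  have -> : (1 + x)^-1 - 1 = - (x / (1 + x)) by field; rewrite gt_eqF.
  by lra.
have Rez := Re_le_cn z.
have xa : `|x| <= 5 / 2 * cn z.
  have k : cn z * cn z <= cn z * 2^-1 by rewrite ler_wpM2l.
  move: Rez (mulr_ge0 z0 z0); rewrite /x expr2 !ler_norml => /andP[? ?] ?.
  by apply/andP; split; lra.
have xx : x ^+ 2 <= 25 / 4 * cn z ^+ 2.
  rewrite -real_normK ?num_real// !expr2.
  by have := ler_pM (normr_ge0 x) (normr_ge0 x) xa xa; lra.
have low2 : x - 25 * cn z ^+ 2 <= x / (1 + x).
  rewrite ler_pdivlMr//; have := sqr_ge0 (cn z); nra.
by rewrite ler_norml; apply/andP; split; move: up low lnE low2; rewrite /x; have := sqr_ge0 (cn z); lra.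
Qed.

Lemma ln_cn_deriv f z l : f z != 0 -> cderiv f z l -> forall e, 0 < e ->
  exists2 d, 0 < d & forall w, cn (w - z) < d ->
  `|ln (cn (f w)) - ln (cn (f z)) - complex.Re (l / f z * (w - z))| <= e * cn (w - z).
Proof.
move=> fz0 hf e e0; set a := cn (f z); have a0 : 0 < a by rewrite cn_gt0.
pose e1 := Num.min 1 (e / 2 * a).
have e10 : 0 < e1 by rewrite lt_min ltr01 mulr_gt0 ?divr_gt0.
have [d d0 hd] := hf _ e10.
have L0 := cn_ge0 l; pose K := (cn l + 1) / a.
have K0 : 0 < K by rewrite divr_gt0//; lra.
pose d' := Num.min d (Num.min (2 * K)^-1 (e / 26 / K ^+ 2)).
have K1 : 0 < (2 * K)^-1 by rewrite invr_gt0; lra.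
have K2 : 0 < e / 26 / K ^+ 2 by apply: divr_gt0; [lra|exact: exprn_gt0].
exists d' => [|w]; first by rewrite !lt_min d0 K1.
rewrite !lt_min => /andP[/hd wd /andP[w1 w2]].
set h := w - z in wd w1 w2 *; have h0 := cn_ge0 h.
set ze := (f w - f z) / f z.
have zeE : ze - l / f z * h = (f w - f z - l * h) / f z by rewrite /ze; field.
have err : cn (ze - l / f z * h) <= e / 2 * cn h.
  rewrite zeE cnM cnV -/a ler_pdivrMr//; apply: (le_trans wd).
  have e1a : e1 <= e / 2 * a by rewrite /e1 ge_min lexx orbT.
  by have := ler_wpM2r h0 e1a; lra.
have zeK : cn ze <= K * cn h.
  have k1 : cn (ze - l / f z * h) <= cn h / a.
    rewrite zeE cnM cnV -/a ler_pM2r ?invr_gt0//; apply: (le_trans wd).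
    have e11 : e1 <= 1 by rewrite /e1 ge_min lexx.
    by have := ler_wpM2r h0 e11; lra.
  have := cnD (ze - l / f z * h) (l / f z * h); rewrite subrK !cnM cnV -/a.
  by rewrite /K; move: k1; move: (a^-1) => y; lra.
have ze2 : cn ze <= 2^-1.
  apply: (le_trans zeK); move: w1; rewrite invfM ltr_pdivlMr//; lra.
have fE : f w = f z * (1 + ze) by rewrite /ze; field.
have ze1 : 0 < cn (1 + ze).
  by have := cnD (1 + ze) (- ze); rewrite addrK cnN cn1; lra.
have -> : ln (cn (f w)) = ln a + ln (cn (1 + ze)) by rewrite fE cnM lnM ?posrE.
have := ln_cn1D ze2.
have k2 : `|complex.Re ze - complex.Re (l / f z * h)| <= e / 2 * cn h.
  by rewrite -raddfB; apply: le_trans (Re_le_cn _) err.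
have k3 : 13 * cn ze ^+ 2 <= e / 2 * cn h.
  have k4 : cn ze ^+ 2 <= K ^+ 2 * cn h * cn h.
    by rewrite -mulrA -expr2 -exprMn lerXn2r ?nnegrE ?cn_ge0// mulr_ge0// ltW.
  have k5 : K ^+ 2 * cn h <= e / 26.
    by move: w2; rewrite ltr_pdivlMr ?exprn_gt0//; lra.
  have : K ^+ 2 * cn h * cn h <= e / 26 * cn h by rewrite ler_wpM2r.
  by lra.
move: k2; rewrite !ler_norml => /andP[? ?] /andP[? ?]; apply/andP; split; lra.
Qed.

(** A branch of log (f / f(c)), obtained as a primitive of f' / f: the difference of ln |f| and its
    real part, read as a complex function, has derivative 0 and is therefore constant. *)
Lemma log_re_primitive f c r : 0 < r -> hol_disc f c r ->
  (forall z, cn (z - c) < r -> f z != 0) ->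
  exists2 phi, hol_disc phi c r & phi c = 0 /\ forall z, cn (z - c) < r ->
    ln (cn (f z)) - ln (cn (f c)) = complex.Re (phi z).
Proof.
move=> r0 hf f0.
have dP z : {l | cn (z - c) < r -> cderiv f z l}.
  apply: cid; have [zr|nzr] := pselect (cn (z - c) < r); last by exists 0.
  by have [l hl] := hf z zr; exists l.
pose f1 z := sval (dP z).
have ff1 z : cn (z - c) < r -> cderiv f z (f1 z) := svalP (dP z).
have [|g hg] := @primitive_disc R (fun z => f1 z * (f z)^-1) c r.
  move=> z zr; have [m hm] := cderiv_deriv ff1 zr.
  by eexists; apply: cderivM hm (cderivV (f0 z zr) (ff1 z zr)).
exists (fun z => g z - g c).
  by move=> z zr; eexists; apply: cderivB (hg z zr) (cderiv_cst _ _).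
split=> [|z zr]; first by rewrite subrr.
pose h w := ((ln (cn (f w)) - complex.Re (g w))%:C)%C.
have hd w : cn (w - c) < r -> cderiv h w 0.
  move=> wr e e0; have e2 : 0 < e / 2 by rewrite divr_gt0.
  have [d1 d10 h1] := ln_cn_deriv (f0 w wr) (ff1 w wr) e2.
  have [d2 d20 h2] := hg w wr _ e2.
  exists (Num.min d1 d2) => [|x]; first by rewrite lt_min d10.
  rewrite lt_min => /andP[/h1 k1 /h2 k2].
  rewrite mul0r subr0 /h -rmorphB cn_real.
  have : `|complex.Re (g x - g w - f1 w / f w * (x - w))| <= e / 2 * cn (x - w).
    exact: le_trans (Re_le_cn _) k2.
  rewrite !raddfB/=; move: k1; rewrite !ler_norml => /andP[? ?] /andP[? ?].
  by apply/andP; split; lra.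
have cr : cn (c - c) < r by rewrite subrr cn0.
have h00 w : cn (w - c) < r -> cn (0 : R[i]) <= 0 by rewrite cn0.
have := mean_value_ineq hd h00 cr zr; rewrite mul0r => hz.
have {hz} : cn (h z - h c) == 0 by rewrite eq_le hz cn_ge0.
rewrite cn_eq0 subr_eq0 => /eqP[]; rewrite raddfB/=; lra.
Qed.

(* Borel-Caratheodory: [phi / (2 A - phi)] maps the disc into the unit disc
   when [Re phi <= A], and vanishes at the centre. *)
Lemma log_harnack f c r A : 0 < r -> 0 < A -> hol_disc f c r ->
  (forall z, cn (z - c) < r -> f z != 0) ->
  (forall z, cn (z - c) < r -> ln (cn (f z)) <= A + ln (cn (f c))) ->
  forall z, cn (z - c) <= r / 128 ->
  `|ln (cn (f z)) - ln (cn (f c))| <= 256 * A * cn (z - c) / r.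
Proof.
move=> r0 A0 hf f0 fA z zr.
have [phi hphi [phic lnE]] := log_re_primitive r0 hf f0.
have zr' : cn (z - c) < r by lra.
have ReA w : cn (w - c) < r -> complex.Re (phi w) <= A.
  by move=> wr; rewrite -lnE//; have := fA w wr; lra.
pose A2 : R[i] := ((2 * A)%:C)%C.
have sub0 w : cn (w - c) < r -> A2 - phi w != 0.
  move=> wr; apply/eqP => /(congr1 (@complex.Re R)); rewrite raddfB/= => k.
  by have := ReA w wr; lra.
pose psi w := phi w * (A2 - phi w)^-1.
have hpsi : hol_disc psi c r.
  move=> w wr; have [l hl] := hphi w wr.
  eexists; apply: cderivM hl (cderivV _ (cderivB (cderiv_cst _ _) hl)).
  exact: sub0.
have psi1 w : cn (w - c) < r -> cn (psi w) <= 1.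
  move=> wr; rewrite /psi cnM cnV ler_pdivrMr ?cn_gt0 ?sub0// mul1r.
  rewrite -ler_sqr ?nnegrE ?cn_ge0// !sqr_cn !raddfB/=.
  have := ReA w wr; move: (complex.Re _) (complex.Im _) => x y xA.
  by rewrite sub0r sqrrN lerD2r; nra.
have dP w : {l | cn (w - c) < r -> cderiv psi w l}.
  apply: cid; have [wr|nwr] := pselect (cn (w - c) < r); last by exists 0.
  by have [l hl] := hpsi w wr; exists l.
have psiL : cn (psi z - psi c) <= 64 / r * cn (z - c).
  apply: (@mean_value_ineq R psi (fun w => sval (dP w)) c (r / 2)).
  - by move=> w wr; apply: svalP (dP w) _; lra.
  - move=> w wr; have -> : 64 / r = 32 * 1 / (r / 2) by field; rewrite gt_eqF.
    apply: (@cauchy_estimate R psi w (r / 2)).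
    + by lra.
    + by move=> x xw; apply: hpsi; have := cn_tri w x c; lra.
    + by move=> x xw; apply: psi1; have := cn_tri w x c; lra.
    + by apply: svalP (dP w) _; lra.
  - by rewrite subrr cn0; lra.
  - by lra.
have psic : psi c = 0 by rewrite /psi phic mul0r.
rewrite psic subr0 in psiL.
have psi2 : cn (psi z) <= 2^-1.
  apply: (le_trans psiL); rewrite mulrAC ler_pdivrMr//; lra.
(* Solved for [phi], this gives |phi| <= 4 A |psi|, as |psi| <= 1/2 on the disc of radius r / 128;
   with |psi| <= 64 |z - c| / r the constant 256 results. *)
have phiE : phi z * (1 + psi z) = A2 * psi z.
  have k := sub0 z zr'; rewrite /psi; set d := A2 - phi z in k *.
  have -> : A2 = d + phi z by rewrite /d subrK.
  by move: (phi z) d k => p d d0; field.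
have low : 2^-1 <= cn (1 + psi z).
  by have := cnD (1 + psi z) (- psi z); rewrite addrK cnN cn1; lra.
rewrite lnE//; apply: le_trans (Re_le_cn _) _.
have : cn (phi z) * cn (1 + psi z) = 2 * A * cn (psi z).
  by rewrite -cnM phiE cnM cn_real gtr0_norm// mulr_gt0.
have k1 : 4 * A * cn (psi z) <= 4 * A * (64 / r * cn (z - c)).
  by rewrite ler_wpM2l// mulr_ge0// ltW.
have k2 : cn (phi z) * 2^-1 <= cn (phi z) * cn (1 + psi z) by rewrite ler_wpM2l ?cn_ge0.
have -> : 256 * A * cn (z - c) / r = 4 * A * (64 / r * cn (z - c)) by field; rewrite gt_eqF.
by lra.
Qed.

End LogHarnack.

(** * Harnack bounds for zero-free functions *)

Section Harnack.
Variable R : realType.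
Implicit Types (a b c p u v z w x y l : R[i]) (e d s r M D A B : R).
Implicit Types (F : nat -> R[i] -> R[i]).

(** A Taylor bound without factorials: the mean value inequality applied k times. *)
Lemma taylor_bound k F x r B : 0 < r -> deriv_chain F x r ->
  (forall w, cn (w - x) < r -> cn (F k w) <= B) ->
  forall w, cn (w - x) < r ->
  cn (F 0%N w) <= \sum_(j < k) cn (F j x) * r ^+ j + r ^+ k * B.
Proof.
move=> r0; elim: k F => [|k IH] F hF FB w wr.
  by rewrite big_ord0 add0r expr0 mul1r FB.
set S := \sum_(j < k) cn (F j.+1 x) * r ^+ j + r ^+ k * B.
have F1 z : cn (z - x) < r -> cn (F 1%N z) <= S.
  by move=> zr; apply: (IH (fun j => F j.+1)) => // j v vr; apply: hF.
have xx : cn (x - x) < r by rewrite subrr cn0.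
have := mean_value_ineq (fun z zr => hF 0%N z zr) F1 xx wr.
have := cnDB (F 0%N w) (F 0%N x).
have S0 : 0 <= S by apply: le_trans (F1 x xx); apply: cn_ge0.
have := ler_wpM2l S0 (ltW wr).
rewrite big_ord_recl/= expr0 mulr1 -addrA.
have -> : \sum_(i < k) cn (F (bump 0 i) x) * r ^+ bump 0 i + r ^+ k.+1 * B = S * r.
  rewrite /S mulrDl mulr_suml exprSr mulrAC; congr (_ + _); apply: eq_bigr => i _.
  by rewrite /bump leq0n add1n exprSr mulrA.
by lra.
Qed.

Lemma deriv_chain_sub F c r z s : deriv_chain F c r -> cn (z - c) + s <= r ->
  deriv_chain F z s.
Proof.
by move=> hF zs j w wz; apply: hF; have := cn_tri z w c; lra.
Qed.

Lemma deriv_chain_hol F c r j : deriv_chain F c r -> hol_disc (F j) c r.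
Proof. by move=> hF z zr; exists (F j.+1 z); apply: hF. Qed.

(** Iterating M -> M / 2 + K from any start tends to 2 K, so the initial bound [M0], which may
    depend on the function, disappears. *)
Lemma half_bound (T : Type) (Q : T -> Prop) (h : T -> R) (K M0 : R) :
  (forall t, Q t -> h t <= M0) ->
  (forall M, (forall t, Q t -> h t <= M) -> forall t, Q t -> h t <= M / 2 + K) ->
  forall t, Q t -> h t <= 2 * K.
Proof.
move=> h0 hs t Qt; apply/ler_addgt0Pr => e e0.
have H m : forall t, Q t -> h t <= 2 * K + `|M0 - 2 * K| / 2 ^+ m.
  elim: m => [|m IH] u Qu.
    by rewrite expr0 divr1; have := h0 u Qu; have := ler_norm (M0 - 2 * K); lra.
  by have := hs _ IH u Qu; rewrite exprS invfM; lra.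
have [m hm] := @geometric_lt R `|M0 - 2 * K| _ e0.
by have := H m t Qt; lra.
Qed.

(** With a = |F 0 x|, a bound M on the disc of radius q improves to a Y on that of radius q / 512,
    where a Y^2 = M + 2 a. Cauchy's estimates there and Taylor's formula return C1 a Y + C2 on the
    large disc, and 2 C1 Y <= C1^2 + Y^2 turns this into M / 2 + K. *)
Lemma harnack_le k r : 0 < r -> exists2 C, 0 <= C & forall z0 F,
  deriv_chain F z0 r -> (forall z, cn (z - z0) < r -> F 0%N z != 0) ->
  (forall z, cn (z - z0) < r -> cn (F k z) <= 1) ->
  forall x y, cn (x - z0) < r / 8 -> cn (y - z0) < r / 8 ->
  cn (F 0%N y) <= C * (cn (F 0%N x) + 1).
Proof.
move=> r0; pose Cj j := s2val (cid2 (cauchy_estimate_iter R j)).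
have Cj0 j : 0 < Cj j by rewrite /Cj; case: cid2.
have CjP j F c s M : 0 < s -> deriv_chain F c s ->
    (forall z, cn (z - c) < s -> cn (F 0%N z) <= M) -> cn (F j c) <= Cj j * M / s ^+ j.
  by rewrite /Cj; case: cid2 => C ? /= H; apply: H.
pose q := r / 2; have q0 : 0 < q by rewrite divr_gt0.
pose C1 := \sum_(j < k) Cj j * 512 ^+ j.
have C10 : 0 <= C1.
  by apply: sumr_ge0 => j _; rewrite mulr_ge0 ?exprn_ge0 ?ler0n// ltW.
pose C2 := q ^+ k; have C20 : 0 <= C2 by rewrite exprn_ge0// ltW.
exists (2 + C1 ^+ 2 + 2 * C2) => [|z0 F hF F0 Fk x y xz yz].
  by rewrite !addr_ge0 ?exprn_ge0 ?mulr_ge0.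
have xr : cn (x - z0) < r by lra.
set a := cn (F 0%N x); have a0 : 0 < a by rewrite cn_gt0 F0.
have sub w : cn (w - x) < q -> cn (w - z0) < r.
  by rewrite /q; have := cn_tri x w z0; lra.
have hFx : deriv_chain F x q by apply: deriv_chain_sub hF _; rewrite /q; lra.
have step M : (forall w, cn (w - x) < q / 512 -> cn (F 0%N w) <= M) ->
    forall w, cn (w - x) < q -> cn (F 0%N w) <= C1 * M + C2.
  move=> FM w wq.
  have q5 : 0 < q / 512 by rewrite divr_gt0 ?ltr0n.
  have hFx5 : deriv_chain F x (q / 512).
    by apply: deriv_chain_sub hF _; rewrite /q; lra.
  have := taylor_bound q0 hFx (fun w wq => Fk w (sub w wq)) wq.
  rewrite mulr1 => h; apply: (le_trans h); rewrite lerD2r /C1 mulr_suml.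
  apply: ler_sum => j _; rewrite -ler_pdivlMr ?exprn_gt0//.
  apply: le_trans (CjP j _ _ _ _ q5 hFx5 FM) _.
  rewrite expr_div_n invf_div le_eqVlt; apply/orP; left; apply/eqP.
  have : q ^+ j != 0 by rewrite expf_neq0 ?gt_eqF.
  by move: (q ^+ j) => Y Y0; field.
pose K := a + C1 ^+ 2 * a / 2 + C2.
suff : forall w, cn (w - x) < q -> cn (F 0%N w) <= 2 * K.
  move=> /(_ y); have yx := cn_tri z0 y x; rewrite (cnB z0) in yx.
  move=> /(_ ltac:(rewrite /q; lra)) h; apply: (le_trans h); rewrite /K.
  have := mulr_ge0 C20 (ltW a0); have := sqr_ge0 C1; lra.
pose M0 := \sum_(j < k) cn (F j x) * q ^+ j + q ^+ k * 1.
apply: (@half_bound R[i] _ (fun w => cn (F 0%N w)) K M0).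
  exact: taylor_bound q0 hFx (fun w wq => Fk w (sub w wq)).
move=> M FM.
have M0' : 0 <= M.
  by apply: le_trans (FM x _); rewrite ?cn_ge0// subrr cn0.
have t0 : 0 < (M + 2 * a) / a by rewrite divr_gt0//; lra.
(* The summand 2 a makes [A] positive whatever M is. On the radius q / 512 Borel-Caratheodory allows
   a change of at most 256 A / 512 = A / 2, the square root of the full factor. *)
pose A := ln ((M + 2 * a) / a).
have A0 : 0 < A by rewrite ln_gt0// ltr_pdivlMr//; lra.
pose Y := expR (A / 2).
have Y0 : 0 < Y := expR_gt0 _.
have YY : a * (Y * Y) = M + 2 * a.
  rewrite /Y -expRD; have -> : A / 2 + A / 2 = A by field.
  by rewrite lnK ?posrE//; field; rewrite gt_eqF.
have loc w : cn (w - x) < q / 512 -> cn (F 0%N w) <= a * Y.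
  move=> wq; have w0 : 0 < cn (F 0%N w) by rewrite cn_gt0 F0// sub//; lra.
  have ubd z : cn (z - x) < q -> ln (cn (F 0%N z)) <= A + ln a.
    move=> zq; rewrite -lnM ?posrE// divfK ?gt_eqF// ler_ln ?posrE.
    - by have := FM z zq; lra.
    - by rewrite cn_gt0 F0// sub.
    - by lra.
  have wq' : cn (w - x) <= q / 128 by lra.
  have := log_harnack q0 A0 (deriv_chain_hol 0 hFx) (fun z zq => F0 z (sub z zq)) ubd wq'.
  have : 256 * A * cn (w - x) / q <= A / 2.
    rewrite ler_pdivrMr//; have := ler_wpM2l (ltW A0) (ltW wq); lra.
  move=> k1 /le_trans/(_ k1); rewrite ler_norml => /andP[_ k2].
  rewrite -(ler_ln (x := cn _)) ?posrE// ?mulr_gt0// lnM ?posrE// expRK; lra.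
move=> w wq; apply: le_trans (step _ loc w wq) _; rewrite /K.
have := mulr_ge0 (ltW a0) (sqr_ge0 (Y - C1)); rewrite !expr2; move: YY; lra.
Qed.

(** With n = k + 1, e^t = (e^(t/n))^n >= (t / n)^n, which is of higher degree than t^k. *)
Lemma expR_dominates (K : R) k : exists2 L, 1 <= L &
  forall t, L <= t -> K * t ^+ k < expR t.
Proof.
pose n := k.+1; have n0 : 0 < n%:R :> R by rewrite ltr0n.
pose N : R := n%:R ^+ n; have N0 : 0 < N by rewrite exprn_gt0.
exists (`|K| * N + 1) => [|t tL].
  by rewrite lerDr mulr_ge0// ltW.
have KN : 0 <= `|K| * N by rewrite mulr_ge0// ltW.
have t0 : 0 < t by lra.
have h : (t / n%:R) ^+ n <= expR t.
  have -> : expR t = expR (t / n%:R) ^+ n.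
    by rewrite -expRM_natl mulrC divfK// gt_eqF.
  rewrite lerXn2r ?nnegrE ?expR_ge0 ?divr_ge0// ?ltW//.
  by have := expR_ge1Dx (t / n%:R); lra.
apply: lt_le_trans h; rewrite expr_div_n -/N ltr_pdivlMr// exprS.
have tk : 0 < t ^+ k by rewrite exprn_gt0.
have : K * N < t by have := ler_norm (K * N); rewrite normrM (gtr0_norm N0); lra.
by move=> KNt; have := ltr_pM2r tk (K * N) t; rewrite KNt => k1; rewrite mulrAC k1.
Qed.

Lemma hol_disc_inv f c r : hol_disc f c r ->
  (forall z, cn (z - c) < r -> f z != 0) -> hol_disc (fun z => (f z)^-1) c r.
Proof.
move=> hf f0 z zr; have [l hl] := hf z zr.
by eexists; apply: cderivV hl; apply: f0.
Qed.

(* Where [1/|f|] grows at most by [e^A], [f] is nearly constant at scale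
   [R / A], so that Cauchy's estimate turns [|f^(k)| >= 1] into a lower bound
   for [|f|]. *)
Lemma lower_bound_pointwise k : exists2 C, 0 < C & forall F z s A,
  0 < s -> 1 <= A -> deriv_chain F z s ->
  (forall w, cn (w - z) < s -> F 0%N w != 0) -> 1 <= cn (F k z) ->
  (forall w, cn (w - z) < s -> - ln (cn (F 0%N w)) <= A - ln (cn (F 0%N z))) ->
  1 <= C * cn (F 0%N z) * (A / s) ^+ k.
Proof.
have [C C0 hC] := cauchy_estimate_iter R k.
exists (C * expR 1 * 256 ^+ k) => [|F z s A s0 A1 hF F0 Fk FA].
  by rewrite !mulr_gt0 ?expR_gt0 ?exprn_gt0 ?ltr0n.
have A0 : 0 < A by lra.
have zz : cn (z - z) < s by rewrite subrr cn0.
(* At this radius Borel-Caratheodory for 1 / f allows ln |f| to change by at most 256 A d / s =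
   1. *)
pose d := s / (256 * A); have d0 : 0 < d by rewrite divr_gt0// mulr_gt0 ?ltr0n.
have dA : d * A = s / 256 by rewrite /d; field; rewrite gt_eqF.
have d1 : d <= s / 256 by rewrite -dA ler_peMr// ltW.
have hFd : deriv_chain F z d.
  by apply: deriv_chain_sub hF _; rewrite subrr cn0; lra.
have := hC F z d (expR 1 * cn (F 0%N z)) d0 hFd _.
suff bd w : cn (w - z) < d -> cn (F 0%N w) <= expR 1 * cn (F 0%N z).
  move=> /(_ bd) /(le_trans Fk) h; apply: (le_trans h).
  rewrite le_eqVlt; apply/orP; left; apply/eqP.
  have -> : A / s = (d * 256)^-1 by rewrite /d; field; rewrite !gt_eqF.
  rewrite exprVn [(d * 256) ^+ k]exprMn; have : d ^+ k != 0 by rewrite expf_neq0 ?gt_eqF.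
  have : (256 : R) ^+ k != 0 by rewrite expf_neq0 ?pnatr_eq0.
  by move: (256 ^+ k) (d ^+ k) (expR 1) => x y v x0 y0; field; rewrite x0 y0.
move=> wd; have ws : cn (w - z) < s by lra.
have cw : 0 < cn (F 0%N w) by rewrite cn_gt0 F0.
have cz : 0 < cn (F 0%N z) by rewrite cn_gt0 F0.
have lnV' v : cn (v - z) < s -> ln (cn (F 0%N v)^-1) = - ln (cn (F 0%N v)).
  by move=> vs; rewrite cnV lnV// posrE cn_gt0 F0.
have h1 v : cn (v - z) < s -> (F 0%N v)^-1 != 0.
  by move=> vs; rewrite invr_eq0 F0.
have h2 v : cn (v - z) < s ->
    ln (cn (F 0%N v)^-1) <= A + ln (cn (F 0%N z)^-1).
  by move=> vs; rewrite !lnV'//; have := FA v vs; lra.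
have ws' : cn (w - z) <= s / 128 by lra.
have := log_harnack s0 A0 (hol_disc_inv (deriv_chain_hol 0 hF) F0) h1 h2 ws'.
rewrite !lnV'//.
have : 256 * A * cn (w - z) / s <= 1.
  by rewrite ler_pdivrMr//; have := ler_wpM2l (ltW A0) (ltW wd); lra.
move=> k1 /le_trans/(_ k1); rewrite ler_norml => /andP[k2 _].
by rewrite -(ler_ln (x := cn _)) ?posrE// ?mulr_gt0 ?expR_gt0// lnM ?posrE ?expR_gt0// expRK; lra.
Qed.

Lemma lower_bound_disc k r : 0 < r -> exists2 c, 0 < c & forall z0 F,
  deriv_chain F z0 r -> (forall z, cn (z - z0) < r -> F 0%N z != 0) ->
  (forall z, cn (z - z0) < r -> 1 <= cn (F k z)) ->
  forall x, cn (x - z0) < r / 4 -> c <= cn (F 0%N x).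
Proof.
move=> r0; have [C C0 hC] := lower_bound_pointwise k.
pose q := r / 4; have q0 : 0 < q by rewrite divr_gt0.
(* The exponent is 2 k because the radius of step n, q / 2^(n+1), brings a factor 2^(n k) that is
   absorbed using 2^n <= [lf w]. *)
have [L L1 hL] := expR_dominates (C * (2 / q) ^+ k) (2 * k).
exists (expR (- L)) => [|z0 F hF F0 Fk x xz]; first exact: expR_gt0.
rewrite leNgt; apply/negP => xL.
pose lf w := - ln (cn (F 0%N w)).
have sub w : cn (w - x) <= 2 * q -> cn (w - z0) < r.
  by have := cn_tri x w z0; rewrite /q; lra.
have pos w : cn (w - x) <= 2 * q -> 0 < cn (F 0%N w).
  by move=> wq; rewrite cn_gt0 F0 ?sub.
have xx : cn (x - x) <= 2 * q by rewrite subrr cn0; lra.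
(* q - q / 2^n is the sum of the first n step lengths q / 2^(i+1), so the points stay within q of
   [x]. *)
pose Q n w := cn (w - x) <= q - q / 2 ^+ n /\ 2 ^+ n * L <= lf w.
pose S n w w' := cn (w' - w) <= (q / 2) / 2 ^+ n.
have [||u u0 hu] := @dependent_choice_rel _ Q S x.
- split; first by rewrite subrr cn0 expr0 divr1 subrr.
  rewrite expr0 mul1r /lf lerNr; rewrite -(expRK (- L)) ler_ln ?posrE ?expR_gt0 ?pos//.
  exact: ltW.
- move=> n w [wq wL].
  have h0 : 0 < (2 : R) ^+ n by rewrite exprn_gt0.
  have qn : 0 < q / 2 ^+ n by rewrite divr_gt0.
  have qS : q / 2 ^+ n.+1 = q / 2 ^+ n / 2 by rewrite exprS invfM; lra.
  have n1 : 1 <= (2 : R) ^+ n by rewrite exprn_ege1// ler1n.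
  have wL1 : L <= lf w by apply: le_trans wL; rewrite ler_peMl//; lra.
  have wL2 : 2 ^+ n <= lf w by apply: le_trans wL; rewrite ler_peMr//; lra.
  apply: contrapT => nex.
  have wx : cn (w - x) <= 2 * q by lra.
  have near w' : cn (w' - w) < q / 2 ^+ n.+1 -> cn (w' - x) <= q - q / 2 ^+ n.+1.
    by move=> ww; have := cn_tri w w' x; lra.
  have near2 w' : cn (w' - w) < q / 2 ^+ n.+1 -> cn (w' - x) <= 2 * q.
    by move=> /near; lra.
  have := hC F w (q / 2 ^+ n.+1) (lf w) _ _ _ _ _ _.
  have s0 : 0 < q / 2 ^+ n.+1 by rewrite qS; lra.
  have A1 : 1 <= lf w by lra.
  have hFw : deriv_chain F w (q / 2 ^+ n.+1).
    apply: deriv_chain_sub hF _; have := cn_tri x w z0; rewrite /q in wq qS qn *; lra.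
  have wr := sub w wx.
  (* If no point nearby doubles [lf], then -ln |F 0| <= 2 [lf w] there, which is the growth
     hypothesis of [lower_bound_pointwise] with A = [lf w]. *)
  have FA w' : cn (w' - w) < q / 2 ^+ n.+1 ->
      - ln (cn (F 0%N w')) <= lf w - ln (cn (F 0%N w)).
    move=> ww; rewrite leNgt; apply/negP => k1; apply: nex; exists w'.
      split; first exact: near.
      by rewrite exprS; move: k1 wL; rewrite /lf; lra.
    by rewrite /S; move: ww; rewrite qS; lra.
  move=> /(_ s0 A1 hFw (fun w' h => F0 _ (sub _ (near2 w' h))) (Fk w wr) FA).
  apply/negP; rewrite -ltNge.
  have -> : cn (F 0%N w) = expR (- lf w) by rewrite /lf opprK lnK// posrE pos.
  have t1 : (lf w / (q / 2 ^+ n.+1)) ^+ k <= (2 / q) ^+ k * lf w ^+ (2 * k).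
    rewrite exprM -exprMn; apply: lerXn2r; rewrite ?nnegrE.
    - by rewrite divr_ge0//; lra.
    - by rewrite mulr_ge0 ?exprn_ge0 ?divr_ge0//; lra.
    have -> : lf w / (q / 2 ^+ n.+1) = 2 / q * (2 ^+ n * lf w).
      by rewrite exprS; field; rewrite !gt_eqF.
    rewrite ler_pM2l ?divr_gt0// expr2 ler_pM2r//; lra.
  have e0 := expR_gt0 (- lf w).
  have CE : 0 < C * expR (- lf w) by rewrite mulr_gt0.
  apply: le_lt_trans (ler_wpM2l (ltW CE) t1) _.
  have := hL _ wL1; rewrite -(ltr_pM2l e0) -expRD addNr expR0.
  by rewrite mulrA mulrCA !mulrA.
have [p hp] : exists p, forall n, cn (u n - p) <= 4 * (q / 2) / 2 ^+ n.
  by apply: fast_cauchy => n; have [_] := hu n.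
have px : cn (p - x) <= 2 * q.
  by have := hp 0%N; rewrite u0 cnB expr0 divr1; lra.
have pr := sub p px; have p0 := pos p px.
have [l hl] := deriv_chain_hol 0 hF pr.
have p2 : 0 < cn (F 0%N p) / 2 by rewrite divr_gt0.
have [d d0 hd] := cderiv_cont hl p2.
have l2 : 0 < ln (2 : R) by rewrite ln_gt0// ltr1n.
have D0 : 0 < `|lf p| + ln 2 + 1 by have := normr_ge0 (lf p); lra.
(* The second term forces 2^n beyond |lf p| + ln 2 + 1, whereas continuity at [p] keeps [lf (u n)]
   below lf p + ln 2. *)
have d'0 : 0 < Num.min d (2 * q / (`|lf p| + ln 2 + 1)).
  by rewrite lt_min d0 divr_gt0// mulr_gt0.
have [n hn] := @geometric_lt R (4 * (q / 2)) _ d'0.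
move: hn; rewrite lt_min => /andP[hn1 hn2]; have hn := hd _ (le_lt_trans (hp n) hn1).
have [[ux uL] _] := hu n.
have ux2 : cn (u n - x) <= 2 * q.
  by have : 0 < q / 2 ^+ n; [rewrite divr_gt0// exprn_gt0|lra].
have up := pos _ ux2.
have low : cn (F 0%N p) / 2 <= cn (F 0%N (u n)).
  by have := cnDB (F 0%N p) (F 0%N (u n)); rewrite (cnB (F 0%N p)); lra.
have up2 : lf (u n) <= lf p + ln 2.
  have lowl : ln (cn (F 0%N p) / 2) <= ln (cn (F 0%N (u n))) by rewrite ler_ln ?posrE.
  by move: lowl; rewrite ln_div ?posrE// /lf; lra.
have n0 : 0 < (2 : R) ^+ n by rewrite exprn_gt0.
have : `|lf p| + ln 2 + 1 < 2 ^+ n.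
  move: hn2; rewrite ltr_pdivrMr// [ltRHS]mulrAC ltr_pdivlMr// => hn2.
  by rewrite -(ltr_pM2l q0); lra.
have : 2 ^+ n <= 2 ^+ n * L by rewrite ler_peMr// ltW.
have := ler_norm (lf p); lra.
Qed.

(** With |F 0| >= c, the function ln |1 / F 0| exceeds its value at [y] by less than A = ln |F 0 y|
    - ln c + 1. It changes by at most A / 2 between [x] and [y], and solving for |F 0 y| gives the
    square and the factor e / c. *)
Lemma harnack_ge k r : 0 < r -> exists2 C, 0 <= C & forall z0 F,
  deriv_chain F z0 r -> (forall z, cn (z - z0) < r -> F 0%N z != 0) ->
  (forall z, cn (z - z0) < r -> 1 <= cn (F k z)) ->
  forall x y, cn (x - z0) < r / 16 / 512 -> cn (y - z0) < r / 16 / 512 ->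
  cn (F 0%N y) <= C * cn (F 0%N x) ^+ 2.
Proof.
move=> r0; have [c c0 hc] := lower_bound_disc k r0.
exists (expR 1 / c) => [|z0 F hF F0 Fk x y xz yz]; first by rewrite divr_ge0 ?expR_ge0// ltW.
pose q := r / 8; have q0 : 0 < q by rewrite divr_gt0.
have low w : cn (w - y) < q -> c <= cn (F 0%N w).
  by move=> wq; apply: (hc z0 F hF F0 Fk); have := cn_tri y w z0; rewrite /q in wq; lra.
have sub w : cn (w - y) < q -> cn (w - z0) < r.
  by have := cn_tri y w z0; rewrite /q; lra.
have hFy : deriv_chain F y q by apply: deriv_chain_sub hF _; rewrite /q; lra.
have yy : cn (y - y) < q by rewrite subrr cn0.
have pos w : cn (w - y) < q -> 0 < cn (F 0%N w) by move=> wq; rewrite cn_gt0 F0// sub.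
have lnc w : cn (w - y) < q -> ln c <= ln (cn (F 0%N w)).
  by move=> wq; rewrite ler_ln ?posrE ?pos// low.
pose A := ln (cn (F 0%N y)) - ln c + 1.
have A0 : 0 < A by have := lnc y yy; rewrite /A; lra.
have xy : cn (x - y) <= q / 512.
  by have := cn_tri z0 x y; rewrite (cnB z0) /q; lra.
have xyq : cn (x - y) < q by lra.
have xyq' : cn (x - y) <= q / 128 by lra.
have F0' w : cn (w - y) < q -> F 0%N w != 0 by move=> wq; rewrite F0 ?sub.
have h1 v : cn (v - y) < q -> (F 0%N v)^-1 != 0.
  by move=> vs; rewrite invr_eq0 F0'.
have lnV' v : cn (v - y) < q -> ln (cn (F 0%N v)^-1) = - ln (cn (F 0%N v)).
  by move=> vs; rewrite cnV lnV// posrE pos.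
have h2 v : cn (v - y) < q -> ln (cn (F 0%N v)^-1) <= A + ln (cn (F 0%N y)^-1).
  by move=> vs; rewrite !lnV'// /A; have := lnc v vs; lra.
have := log_harnack q0 A0 (hol_disc_inv (deriv_chain_hol 0 hFy) F0') h1 h2 xyq'.
rewrite !lnV'//.
have : 256 * A * cn (x - y) / q <= A / 2.
  by rewrite ler_pdivrMr//; have := ler_wpM2l (ltW A0) xy; lra.
move=> k1 /le_trans/(_ k1); rewrite ler_norml => /andP[_ k2].
have px := pos x xyq; have e1 := expR_gt0 (1 : R).
have py := pos y yy; have ec : 0 < expR 1 / c by rewrite divr_gt0.
have px2 : 0 < cn (F 0%N x) ^+ 2 by rewrite exprn_gt0.
have bp : 0 < expR 1 / c * cn (F 0%N x) ^+ 2 by rewrite mulr_gt0.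
suff : ln (cn (F 0%N y)) <= ln (expR 1 / c * cn (F 0%N x) ^+ 2).
  by rewrite ler_ln ?posrE.
rewrite lnM ?posrE// ln_div ?posrE// expRK lnXn// -mulr_natl.
by move: k2; rewrite /A; lra.
Qed.

Lemma harnack_disc k r : 0 < r ->
  exists rho, 0 < rho /\ rho <= r /\ exists Phi : R -> R,
  {in Num.nneg &, {homo Phi : s t / s <= t}} /\ forall z0 F,
  deriv_chain F z0 r -> (forall z, cn (z - z0) < r -> F 0%N z != 0) ->
  ((forall z, cn (z - z0) < r -> cn (F k z) <= 1) \/
   (forall z, cn (z - z0) < r -> 1 <= cn (F k z))) ->
  forall x y, cn (x - z0) < rho -> cn (y - z0) < rho ->
  cn (F 0%N y) <= Phi (cn (F 0%N x)).
Proof.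
move=> r0; have [C1 C10 h1] := harnack_le k r0; have [C2 C20 h2] := harnack_ge k r0.
exists (r / 16 / 512); split; first by rewrite !divr_gt0 ?ltr0n.
split; first by lra.
exists (fun t => C1 * (t + 1) + C2 * t ^+ 2); split.
  move=> s t; rewrite !nnegrE => s0 t0 st; rewrite lerD// ler_wpM2l ?lerD2r//.
  by rewrite lerXn2r.
move=> z0 F hF F0 [Fk|Fk] x y xr yr.
- apply: le_trans (h1 z0 F hF F0 Fk x y _ _) _; [lra|lra|].
  by rewrite lerDl mulr_ge0// exprn_ge0 ?cn_ge0.
- apply: le_trans (h2 z0 F hF F0 Fk x y _ _) _; [lra|lra|].
  by rewrite lerDr mulr_ge0// addr_ge0 ?cn_ge0.
Qed.

End Harnack.

(** * Coordinate slices *)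

Section Bridge.
Variable R : realType.
Implicit Types (a b c u w x y z l : R[i]) (e d s r M A B : R).

Lemma cn_ltE z e : (`|z| < (e%:C)%C) = (cn z < e).
Proof. by rewrite cn_norm ltcR. Qed.

Lemma cn_leE z e : (`|z| <= (e%:C)%C) = (cn z <= e).
Proof. by rewrite cn_norm lecR. Qed.

Lemma complex_gt0 (e : R[i]) : 0 < e -> e = ((complex.Re e)%:C)%C /\ 0 < complex.Re e.
Proof. by case: e => x y; rewrite ltcE/= => /andP[/eqP -> x0]; split. Qed.

Lemma derivable_cderiv (V : normedModType R[i]) (f : V -> R[i]) (a v : V) :
  derivable f a v -> cderiv (fun h => f (h *: v + a)) 0 ('D_v f a).
Proof.
move=> fav e e0; have := fav; rewrite /derivable => cv.
have {}cv : h^-1 *: ((f \o shift a) (h *: v) - f a) @[h --> 0^'] --> 'D_v f a := cv.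
have eC : (0 : R[i]) < (e%:C)%C by rewrite ltcR.
move/cvgrPdist_le : cv => /(_ _ eC) /nbhs_ballP[d /= d0 hd].
have [dE dR] := complex_gt0 d0.
exists (complex.Re d) => // w; rewrite subr0 => wd.
have [->|w0] := eqVneq w 0; first by rewrite scale0r add0r mulr0 !subrr cn0 mulr0.
have := hd w; rewrite /ball/= sub0r normrN dE cn_ltE => /(_ wd w0).
rewrite cn_leE => k; rewrite scale0r add0r.
have -> : f (w *: v + a) - f a - 'D_v f a * w =
   - (w * ('D_v f a - w^-1 * (f (w *: v + a) - f a))).
  by rewrite mulrBr mulVKf// opprB [w * _]mulrC.
by rewrite cnN cnM mulrC ler_wpM2r ?cn_ge0.
Qed.

Lemma cderiv_derive (V : normedModType R[i]) (f : V -> R[i]) (a v : V) l :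
  cderiv (fun h => f (h *: v + a)) 0 l -> 'D_v f a = l.
Proof.
move=> hf; apply/cvg_lim; first exact: norm_hausdorff.
apply/cvgrPdist_le => e /complex_gt0[-> e0].
have [d d0 hd] := hf _ e0.
apply/nbhs_ballP; exists (d%:C)%C => /=; first by rewrite ltcR.
move=> w; rewrite /ball/= sub0r normrN cn_ltE => wd w0.
have := hd w; rewrite subr0 scale0r add0r => /(_ wd) k.
rewrite cn_leE; have -> : l - w^-1 *: (f (w *: v + a) - f a) =
    - (w^-1 * (f (w *: v + a) - f a - l * w)).
  by rewrite mulrBr [l * w]mulrC mulKf// opprB.
by rewrite cnN cnM cnV ler_pdivrMl ?cn_gt0// [leRHS]mulrC.
Qed.

End Bridge.

Section Polydisc.
Variables (R : realType) (n : nat).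
Implicit Types (x y z v : 'rV[R[i]]_n) (r s d e : R) (i j : 'I_n).

Definition polydisc z r x := forall i, cn (x 0 i - z 0 i) < r.

Lemma polydisc_center z r : 0 < r -> polydisc z r z.
Proof. by move=> r0 i; rewrite subrr cn0. Qed.

Lemma polydisc_le z r s x : r <= s -> polydisc z r x -> polydisc z s x.
Proof. by move=> rs h i; apply: lt_le_trans (h i) rs. Qed.

Lemma nbhs_polydisc z (A : set 'rV[R[i]]_n) :
  nbhs z A <-> exists2 r, 0 < r & polydisc z r `<=` A.
Proof.
split=> [/nbhs_ballP[e /= /complex_gt0[eE e0] eA]|[r r0 rA]].
  exists (complex.Re e) => // x xe; apply: eA; split; first by rewrite eE ltcR.
  move=> i j.
  by rewrite ord1 eE -ball_normE /= cn_ltE cnB.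
apply/nbhs_ballP; exists (r%:C)%C; first by rewrite /= ltcR.
move=> x [_ xr]; apply: rA => i; have := xr 0 i.
by rewrite -ball_normE /= cn_ltE cnB.
Qed.

Definition slice x i (t : R[i]) : 'rV[R[i]]_n := t *: delta_mx 0 i + x.

Lemma sliceE x i t j : slice x i t 0 j = x 0 j + (if j == i then t else 0).
Proof.
rewrite /slice !mxE eqxx/=; case: (j == i); by rewrite ?mulr1 ?mulr0 addrC.
Qed.

Lemma slice_add x i (s t : R[i]) : slice x i (s + t) = s *: delta_mx 0 i + slice x i t.
Proof. by rewrite /slice scalerDl addrA. Qed.

Lemma polydisc_slice z r x i t : polydisc z r x ->
  cn (t - (z 0 i - x 0 i)) < r -> polydisc z r (slice x i t).
Proof.
move=> xr tr j; rewrite sliceE; case: eqP => [->|_]; last by rewrite addr0.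
by have -> : x 0 i + t - z 0 i = t - (z 0 i - x 0 i) by ring.
Qed.

(** The parameter is 0 at [x], so the slice meets the polydisc in the disc of centre
    [z 0 i - x 0 i]. Only one derivative of [f] is given; the iterated partials exist by
    [cderiv_deriv], one order at a time. *)
Lemma slice_chain (D : set 'rV[R[i]]_n) (f : 'rV[R[i]]_n -> R[i]) z r x i :
  holomorphic_on D f -> polydisc z r `<=` D -> polydisc z r x ->
  deriv_chain (fun k t => partialk k i f (slice x i t)) (z 0 i - x 0 i) r.
Proof.
move=> fD zD xr; pose Fc k t := partialk k i f (slice x i t).
have der k t l : cderiv (Fc k) t l -> l = Fc k.+1 t.
  move=> h; symmetry; apply: cderiv_derive.
  have := @cderiv_affine R (Fc k) t 1 0 l; rewrite mulr0 addr0 mul1r => /(_ h).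
  by apply: (@cderiv_eq_near _ _ _ _ _ 1) => // w _; rewrite /Fc mul1r addrC slice_add.
have : forall k, hol_disc (Fc k) (z 0 i - x 0 i) r.
  elim=> [|k IH].
    move=> t tr; have dt : differentiable f (slice x i t).
      by apply: fD; apply: zD; apply: polydisc_slice.
    have := derivable_cderiv (diff_derivable (v := delta_mx 0 i) dt).
    set l := 'D_ _ _ _ => h; exists l.
    have h' : cderiv (fun h => f (h *: delta_mx 0 i + slice x i t)) (t - t) l.
      by rewrite subrr.
    have := cderiv_shift (f := fun h => f (h *: delta_mx 0 i + slice x i t)) (z := t) (w := - t) h'.
    apply: (@cderiv_eq_near _ _ _ _ _ 1) => // w _.
    by rewrite -slice_add subrK.
  apply: (@cderiv_deriv R (Fc k)) => t /IH[l hl].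
  by rewrite -(der _ _ _ hl).
by move=> hol k t tr; have [l hl] := hol k t tr; rewrite -/(Fc k.+1 t) -(der _ _ _ hl).
Qed.

(** The path runs through the points whose first m coordinates are those of [y] and the others those
    of [x]; a polydisc, being a product, contains them all. *)
Lemma coordinatewise_ind z r x y (Q : nat -> 'rV[R[i]]_n -> Prop) :
  polydisc z r x -> polydisc z r y -> Q 0%N x ->
  (forall m w i, polydisc z r w -> polydisc z r (slice w i (y 0 i - x 0 i)) ->
     Q m w -> Q m.+1 (slice w i (y 0 i - x 0 i))) ->
  Q n y.
Proof.
move=> xr yr Q0 step.
pose h m : 'rV[R[i]]_n := \row_i if (i < m)%N then y 0 i else x 0 i.
have hr m : polydisc z r (h m).
  by move=> i; rewrite mxE; case: ifP => _; [apply: yr|apply: xr].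
have hn : h n = y by apply/rowP => i; rewrite mxE ltn_ord.
have h0 : h 0%N = x by apply/rowP => i; rewrite mxE.
suff H m : (m <= n)%N -> Q m (h m) by rewrite -hn; apply: H.
elim: m => [|m IH] mn; first by rewrite h0.
have hS : h m.+1 = slice (h m) (Ordinal mn) (y 0 (Ordinal mn) - x 0 (Ordinal mn)).
  apply/rowP => j; rewrite sliceE !mxE ltnS.
  have [->|jm] := eqVneq j (Ordinal mn); first by rewrite /= leqnn ltnn addrC subrK.
  rewrite addr0 leq_eqVlt; suff -> : (val j == m)%N = false by [].
  by apply/eqP => jE; move/eqP: jm; apply; apply: val_inj.
rewrite hS; apply: step => //; first by rewrite -hS.
exact: IH (ltnW mn).
Qed.

End Polydisc.

(** * Local estimates in several variables *)

Section LocalEstimates.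
Variables (R : realType) (n : nat).
Implicit Types (x y z v : 'rV[R[i]]_n) (r s d e M A B : R) (i j : 'I_n).
Implicit Types (D : set 'rV[R[i]]_n) (f : 'rV[R[i]]_n -> R[i]).

Lemma eucl_norm_delta (c : R[i]) i : eucl_norm (c *: delta_mx 0 i) = cn c.
Proof.
rewrite /eucl_norm (bigD1 i)//= big1 ?addr0 => [|j /negPf ji].
  by rewrite !mxE !eqxx mulr1 -sqr_cn sqrtr_sqr ger0_norm ?cn_ge0.
by rewrite !mxE ji andbF mulr0 expr0n addr0.
Qed.

Lemma Dk_pair_delta k f z (c : R[i]) i :
  Dk_pair k f z (c *: delta_mx 0 i) = partialk k i f z * c.
Proof.
rewrite /Dk_pair (bigD1 i)//= big1 ?addr0 => [|j /negPf ji].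
  by rewrite !mxE !eqxx mulr1.
by rewrite !mxE ji andbF !mulr0.
Qed.

Lemma unit_vector_test k f z i :
  (forall v, eucl_norm v = 1 -> f z != 0 /\ Dk_pair k f z v != 1) ->
  f z != 0 /\ cn (partialk k i f z) != 1.
Proof.
move=> h; split.
  by have [] := h (1 *: delta_mx 0 i); rewrite ?eucl_norm_delta ?cn1.
apply/eqP => w1; have w0 : partialk k i f z != 0 by rewrite -cn_gt0 w1.
have [] := h ((partialk k i f z)^-1 *: delta_mx 0 i).
  by rewrite eucl_norm_delta cnV w1 invr1.
by rewrite Dk_pair_delta divff ?eqxx.
Qed.

(** The truth value of |g| < 1 is locally constant, since |g| is continuous and avoids 1; bisection
    makes it constant along segments. *)
Lemma modulus_dichotomy (g : R[i] -> R[i]) (c : R[i]) r : hol_disc g c r ->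
  (forall t, cn (t - c) < r -> cn (g t) != 1) ->
  (forall t, cn (t - c) < r -> cn (g t) <= 1) \/
  (forall t, cn (t - c) < r -> 1 <= cn (g t)).
Proof.
move=> hg g1.
have const (a b : R[i]) : cn (a - c) < r -> cn (b - c) < r ->
    cn (g a) < 1 -> cn (g b) < 1.
  move=> ar br.
  pose t := Num.max (cn (a - c)) (cn (b - c)).
  have tr : t < r by rewrite gt_max ar.
  pose P (_ : R) (a b _ : R[i]) := (cn (g a) < 1) = (cn (g b) < 1).
  have ba0 := cn_ge0 (b - a).
  suff : P (3 * cn (b - a) + 1) a b b by move=> ->.
  apply: (@triangle_bisection R (fun w => cn (w - c) <= t) P) => //.
  - exact: mid_closed_disc.
  - by move=> s x y w _ _ _ _ p1 p2 _ _; rewrite /P p1 p2.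
  - move=> p pt; have pr : cn (p - c) < r by lra.
    have [l gl] := hg p pr.
    have e0 : 0 < `|cn (g p) - 1| / 2 by rewrite divr_gt0// normr_gt0 subr_eq0 g1.
    have [d d0 hd] := cderiv_cont gl e0; exists d => // s x y w _ sd _ _ _ xp yp _.
    suff same u : cn (u - p) <= s -> (cn (g u) < 1) = (cn (g p) < 1).
      by rewrite /P !same.
    move=> us; have := hd u (le_lt_trans us sd).
    have := cnDB (g u) (g p); have := cnDB (g p) (g u); rewrite (cnB (g p)).
    have := g1 p pr; rewrite neq_lt; case: ltP => [h _|h _].
      by rewrite ltr0_norm ?subr_lt0//= => *; apply/idP; lra.
    by rewrite ger0_norm ?subr_ge0//= => *; apply/idP; lra.
  - by lra.
  - by rewrite le_max lexx.
  - by rewrite le_max lexx orbT.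
  - by rewrite le_max lexx orbT.
  - by lra.
  - by rewrite subrr cn0; lra.
  - by lra.
have [[a [ar a1]]|none] := pselect (exists a, cn (a - c) < r /\ cn (g a) < 1).
  by left=> t tr; apply/ltW/(const a).
by right=> t tr; rewrite leNgt; apply/negP => t1; apply: none; exists t.
Qed.

(** [Phi] is iterated once per coordinate, so [B] depends on [A] but not on [f]; the alternative for
    the k-th derivative may vary with the slice. *)
Lemma local_harnack D z k r : 0 < r -> polydisc z r `<=` D ->
  exists2 rho, 0 < rho & rho <= r /\ forall A, exists B,
  forall f, holomorphic_on D f ->
    (forall w i, D w -> f w != 0 /\ cn (partialk k i f w) != 1) ->
  forall x y, polydisc z rho x -> polydisc z rho y ->
  cn (f x) <= A -> cn (f y) <= B.
Proof.
move=> r0 rD; have [rho [rho0 [rhor [Phi [PhiM hPhi]]]]] := harnack_disc k r0.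
exists rho => //; split=> // A; exists (iter n Phi A) => f fD f1 x y xr yr fxA.
pose Q m w := cn (f w) <= iter m Phi A.
apply: (@coordinatewise_ind R n z rho x y Q) => // m w i wr sr Qw.
have wr' := polydisc_le rhor wr.
have inD t : cn (t - (z 0 i - w 0 i)) < r -> D (slice w i t).
  by move=> tr; apply: rD; apply: polydisc_slice.
have ch := slice_chain (i := i) fD rD wr'.
have f0 t : cn (t - (z 0 i - w 0 i)) < r -> f (slice w i t) != 0.
  by move=> tr; have [] := f1 _ i (inD t tr).
have dich := modulus_dichotomy (deriv_chain_hol k ch) (fun t tr => (f1 _ i (inD t tr)).2).
have s0 : slice w i 0 = w by rewrite /slice scale0r add0r.
have k1 : cn (0 - (z 0 i - w 0 i)) < rho.
  by have := wr i; congr (cn _ < _); ring.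
have k2 : cn ((y 0 i - x 0 i) - (z 0 i - w 0 i)) < rho.
  have := sr i; rewrite sliceE eqxx; congr (cn _ < _); ring.
have := hPhi _ _ ch f0 dich 0 (y 0 i - x 0 i) k1 k2.
rewrite /= s0 => h; rewrite /Q/=; apply: (le_trans h).
apply: PhiM => //; first by rewrite nnegrE cn_ge0.
by rewrite nnegrE (le_trans (cn_ge0 (f w)) Qw).
Qed.

(** Equicontinuity of a bounded family: Cauchy's estimate bounds each first partial by [K] on the
    half polydisc, and the n coordinates are moved one at a time. *)
Lemma local_lipschitz D z r M : 0 < r -> polydisc z r `<=` D -> 0 <= M ->
  exists2 L, 0 <= L & forall f, holomorphic_on D f ->
  (forall x, polydisc z r x -> cn (f x) <= M) ->
  forall x y d, polydisc z (r / 2) x -> polydisc z (r / 2) y ->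
  (forall i, cn (y 0 i - x 0 i) <= d) -> cn (f y - f x) <= L * d.
Proof.
move=> r0 rD M0; pose K := 32 * M / (r / 2).
have K0 : 0 <= K by rewrite divr_ge0 ?mulr_ge0//; lra.
exists (n%:R * K) => [|f fD fM x y d xr yr xy]; first by rewrite mulr_ge0.
pose Q m w := cn (f w - f x) <= m%:R * K * d.
apply: (@coordinatewise_ind R n z (r / 2) x y Q) => //.
  by rewrite /Q subrr cn0 !mul0r.
move=> m w i wr sr Qw; rewrite /Q.
have wr' : polydisc z r w by apply: polydisc_le wr; lra.
have ch := slice_chain (i := i) fD rD wr'.
set c := z 0 i - w 0 i in ch.
pose g t := f (slice w i t).
have s0 : slice w i 0 = w by rewrite /slice scale0r add0r.
have r2 : 0 < r / 2 by rewrite divr_gt0.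
have gder t : cn (t - c) < r / 2 -> cderiv g t (partialk 1 i f (slice w i t)).
  by move=> tr; apply: (ch 0%N); lra.
have gK t : cn (t - c) < r / 2 -> cn (partialk 1 i f (slice w i t)) <= K.
  move=> tr; apply: (@cauchy_estimate R g t (r / 2)) => //; last exact: gder.
    move=> u ut; exists (partialk 1 i f (slice w i u)); apply: (ch 0%N).
    by have := cn_tri t u c; lra.
  move=> u ut; apply: fM; apply: polydisc_slice => //.
  by have := cn_tri t u c; rewrite /c; lra.
have k1 : cn (0 - c) < r / 2.
  by have := wr i; rewrite /c; congr (cn _ < _); ring.
have k2 : cn ((y 0 i - x 0 i) - c) < r / 2.
  have := sr i; rewrite sliceE eqxx /c; congr (cn _ < _); ring.
have := mean_value_ineq gder gK k1 k2; rewrite /g s0 subr0 => h.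
have := cn_tri (f w) (f (slice w i (y 0 i - x 0 i))) (f x).
have := ler_wpM2l K0 (xy i); move: Qw; rewrite /Q -natr1; lra.
Qed.

End LocalEstimates.

(** * Subsequences and propagation *)

Section Subsequences.
Variable R : realType.

Lemma extract_subsequence (E : nat -> nat -> Prop) :
  (forall N M, exists2 m, (M <= m)%N & E N m) ->
  exists2 sigma : nat -> nat, (forall m, (sigma m < sigma m.+1)%N) &
    forall N, E N (sigma N).
Proof.
move=> hE; have [m0 _ E0] := hE 0%N 0%N.
have [||u u0 hu] := @dependent_choice_rel _ E (fun _ a b => (a < b)%N) m0 => //.
  by move=> N a _; have [m am Em] := hE N.+1 a.+1; exists m.
by exists u => m; have [] := hu m.
Qed.

(* Tychonoff's theorem, applied to real and imaginary parts. *)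
Lemma pointwise_cluster (T : eqType) (v : nat -> T -> R[i]) (B : T -> R) :
  (forall m x, cn (v m x) <= B x) ->
  exists G : T -> R[i], forall (s : seq T) e N, 0 < e ->
    exists2 m, (N <= m)%N & forall p, p \in s -> cn (v m p - G p) <= e.
Proof.
move=> vB; pose I : eqType := (T * bool)%type.
pose w m (t : I) : R := if t.2 then complex.Im (v m t.1) else complex.Re (v m t.1).
have cpt : forall t : I, compact (`[- B t.1, B t.1]%classic : set R).
  by move=> t; apply: segment_compact.
have /= := tychonoff cpt; set A := [set f | _] => cA.
have [|g [_ cg]] := cA (w m @[m --> \oo]) _.
  exists 0%N => // m _ [x b] /=; rewrite in_itv/= -ler_norml.
  apply: le_trans (vB m x); rewrite /w/=.
  by case: b; [apply: Im_le_cn|apply: Re_le_cn].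
exists (fun x => (g (x, false) +i* g (x, true))%C) => s e N e0.
have e2 : 0 < e / 2 by rewrite divr_gt0.
(* Neighbourhoods in the product control finitely many points at once, hence the finite list. A
   cluster point is all that compactness of a possibly uncountable product gives; subsequences are
   extracted later, along countably many points. *)
pose W (s : seq T) := [set h : I -> R | forall p, p \in s -> forall b,
    ball (g (p, b)) (e / 2) (h (p, b))].
have nW : nbhs (g : prod_topology (fun _ : I => R)) (W s).
  have one (t : I) : nbhs (g : prod_topology (fun _ : I => R))
      [set h : I -> R | ball (g t) (e / 2) (h t)].
    have b : nbhs (g t) (ball (g t) (e / 2)) by apply/nbhs_ballP; exists (e / 2).
    exact: (@proj_continuous I (fun=> R) t g _ b).
  have FF : Filter (nbhs (g : prod_topology (fun _ : I => R))) := nbhs_filter _.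
  elim: s => [|p s IH]; first by apply: (@filterS _ _ FF _ _ _ (@filterT _ _ FF)) => h _ p.
  have := @filterI _ _ FF _ _ IH (@filterI _ _ FF _ _ (one (p, false)) (one (p, true))).
  apply: (@filterS _ _ FF) => h [h1 [h2 h3]] q; rewrite inE => /orP[/eqP ->|qs] b; last exact: h1.
  by case: b.
have nN : (w m @[m --> \oo]) [set h | exists2 m, (N <= m)%N & w m = h].
  by exists N => // m /= Nm; exists m.
have [_ [[m Nm <-] mW]] := cg _ _ nN nW.
exists m => // p ps; apply: le_trans (cn_le_ReIm _) _.
have h1 := mW p ps false; have h2 := mW p ps true.
by move: h1 h2; rewrite /ball/= /w/= !raddfB/= (distrC (g _)) (distrC (g (p, true))); lra.
Qed.

End Subsequences.

Section Globalization.
Variables (R : realType) (n : nat).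
Implicit Types (x y z v : 'rV[R[i]]_n) (r s d e M A B : R) (i j : 'I_n).
Implicit Types (D : set 'rV[R[i]]_n) (f : 'rV[R[i]]_n -> R[i]).

(** The local hypothesis is symmetric in [x] and [y], so both [S] and its complement are open in
    [D]. *)
Lemma connected_propagate D (S : set 'rV[R[i]]_n) : open D -> connected D ->
  (forall z, D z -> exists2 rho, 0 < rho & forall x y,
     polydisc z rho x -> polydisc z rho y -> S x -> S y) ->
  forall z0 z, D z0 -> S z0 -> D z -> S z.
Proof.
move=> oD cD loc z0 z Dz0 Sz0 Dz.
have op (b : bool) : open (D `&` [set x | if b then S x else ~ S x]).
  rewrite openE => x [Dx Sx]; have [rho rho0 hr] := loc x Dx.
  have /nbhs_polydisc[r r0 rD] : nbhs x D by move: oD; rewrite openE => /(_ _ Dx).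
  apply/nbhs_polydisc; exists (Num.min r rho) => [|y xy]; first by rewrite lt_min r0.
  split; first by apply: rD; apply: polydisc_le xy; rewrite ge_min lexx.
  have xy' : polydisc x rho y by apply: polydisc_le xy; rewrite ge_min lexx orbT.
  have xx := polydisc_center x rho0.
  by case: b Sx => /= Sx; [apply: hr xx xy' Sx|move/(hr _ _ xy' xx)].
have := cD (D `&` S).
have -> : D `&` S = D `&` [set x | S x] by [].
move=> /(_ _ _ _)H; suff : (D `&` S) z by case.
rewrite H //.
- by exists z0.
- by exists (D `&` S); [exact: (op true)|rewrite setIA setIid].
- exists (~` (D `&` [set x | ~ S x])); first by apply: open_closedC; exact: (op false).
  apply/seteqP; split=> x [Dx Sx]; split=> //.
    by case.
  by apply: contrapT => nSx; apply: Sx.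
Qed.

Definition rat_point (q : 'rV[rat * rat]_n) : 'rV[R[i]]_n :=
  \row_i (ratr (q 0 i).1 +i* ratr (q 0 i).2)%C.

Lemma rat_point_dense z e : 0 < e -> exists q, polydisc z e (rat_point q).
Proof.
move=> e0; have e2 : 0 < e / 2 by rewrite divr_gt0.
have near (x : R) : {q : rat | `|ratr q - x| < e / 2}.
  apply: cid; have [|q] := @rat_in_itvoo R (x - e / 2) (x + e / 2); first by lra.
  by rewrite in_itv/= => /andP[? ?]; exists q; rewrite ltr_distlC; apply/andP; split; lra.
exists (\row_i (sval (near (complex.Re (z 0 i))), sval (near (complex.Im (z 0 i))))) => i.
apply: le_lt_trans (cn_le_ReIm _) _; rewrite !mxE !raddfB/=.
by have := svalP (near (complex.Re (z 0 i))); have := svalP (near (complex.Im (z 0 i))); lra.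
Qed.

(* Uniform convergence on compact sets is pointwise convergence at rational
   points, by equicontinuity. *)
Lemma locally_bounded_subsequence D (v : nat -> 'rV[R[i]]_n -> R[i]) : open D ->
  (forall m, holomorphic_on D (v m)) ->
  (forall z, D z -> exists2 rho, 0 < rho &
     exists B, forall m x, polydisc z rho x -> cn (v m x) <= B) ->
  exists2 sigma : nat -> nat, (forall m, (sigma m < sigma m.+1)%N) &
  exists g, forall K, K `<=` D -> compact K -> forall e, 0 < e ->
    \forall m \near \oo, forall x, K x -> `|v (sigma m) x - g x| < (e%:C)%C.
Proof.
move=> oD vD bnd.
have Bx x : {B | forall m, D x -> cn (v m x) <= B}.
  apply: cid; have [Dx|nDx] := pselect (D x); last by exists 0.
  by have [rho rho0 [B hB]] := bnd x Dx; exists B => m _; apply/hB/polydisc_center.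
(* Extension by 0 gives pointwise bounds on the whole space, so rational points outside [D] need no
   separate treatment. *)
pose v' m x := if `[< D x >] then v m x else 0.
have [|G hG] := @pointwise_cluster R _ v' (fun x => `|sval (Bx x)|).
  move=> m x; rewrite /v'; case: asboolP => Dx; last by rewrite cn0.
  by apply: le_trans (ler_norm _); apply: (svalP (Bx x)).
pose pt (k : nat) := if unpickle k is Some q then rat_point q else 0.
pose E N m := forall k, (k < N)%N -> cn (v' m (pt k) - G (pt k)) <= 1 / 2 ^+ N.
have [|sigma sigmaS sE] := @extract_subsequence E.
  move=> N M; have [|m Mm hm] := hG [seq pt k | k <- iota 0 N] (1 / 2 ^+ N) M.
    by rewrite divr_gt0 ?exprn_gt0.
  exists m => // i iN; apply: hm; apply/mapP; exists i => //.
  by rewrite mem_iota.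
exists sigma => //; exists G => K KD /compact_near_coveringP cK e e0.
pose P m x := `|v (sigma m) x - G x| < (e%:C)%C.
suff : \forall m \near \oo, K `<=` P m by apply: filterS => m h x /h.
apply: cK => z Kz; have Dz := KD z Kz.
have [rho rho0 [B hB]] := bnd z Dz.
have /nbhs_polydisc[r r0 rD] : nbhs z D by move: oD; rewrite openE => /(_ _ Dz).
pose t := Num.min r rho; have t0 : 0 < t by rewrite lt_min r0.
have tD : polydisc z t `<=` D.
  by move=> x xt; apply: rD; apply: polydisc_le xt; rewrite ge_min lexx.
have hBt m x : polydisc z t x -> cn (v m x) <= B.
  by move=> xt; apply: hB; apply: polydisc_le xt; rewrite ge_min lexx orbT.
have B0 : 0 <= B by apply: le_trans (hBt 0%N z (polydisc_center z t0)); apply: cn_ge0.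
have [L L0 hL] := local_lipschitz t0 tD B0.
have vlip m x y d : polydisc z (t / 2) x -> polydisc z (t / 2) y ->
    (forall i, cn (y 0 i - x 0 i) <= d) -> cn (v m y - v m x) <= L * d.
  exact: (hL (v m) (vD m) (hBt m)).
have v'E m x : polydisc z (t / 2) x -> v' m x = v m x.
  move=> xt; rewrite /v'; case: asboolP => // nDx; exfalso; apply: nDx.
  by apply: tD; apply: polydisc_le xt; lra.
(* [G] inherits the Lipschitz bound because a single [v m] approximates it at both points. *)
have Glip x y d : polydisc z (t / 2) x -> polydisc z (t / 2) y ->
    (forall i, cn (y 0 i - x 0 i) <= d) -> cn (G y - G x) <= L * d.
  move=> xt yt xy; apply/ler_addgt0Pr => h h0; have h2 : 0 < h / 2 by rewrite divr_gt0.
  have [m _ hm] := hG [:: x; y] _ 0%N h2.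
  have := hm x; have := hm y; rewrite !inE !eqxx orbT !v'E// => /(_ isT) k1 /(_ isT) k2.
  have := vlip m x y d xt yt xy.
  have := cn_tri (v m y) (G y) (G x); have := cn_tri (v m x) (v m y) (G x).
  by rewrite (cnB (G y) (v m y)); lra.
(* The rational point [q] is within 2 d of [x] in each coordinate, so passing to [q] in [v] and back
   in [G] costs at most 4 L d <= e / 2; the value at [q] costs less than e / 4. *)
pose d := Num.min (t / 2) (e / (8 * (L + 1))).
have L8 : 0 < 8 * (L + 1) by lra.
have d0 : 0 < d by rewrite lt_min !divr_gt0.
have [q hq] := rat_point_dense z d0.
have dt : d <= t / 2 by rewrite /d ge_min lexx.
have dL : d * (8 * (L + 1)) <= e.
  by rewrite -ler_pdivlMr// /d ge_min lexx orbT.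
have e4 : 0 < e / 4 by rewrite divr_gt0.
have [N hN] := @geometric_lt R 1 _ e4.
(* [(pickle q).+1] because level m of the extraction controls the codes strictly below m. *)
have hz : \forall x \near z & m \near \oo, polydisc z d x /\ (maxn N (pickle q).+1 <= m)%N.
  exists (polydisc z d, [set m | (maxn N (pickle q).+1 <= m)%N]) => /=.
    split; first by apply/nbhs_polydisc; exists d.
    by exists (maxn N (pickle q).+1).
  by case=> x m [].
apply: filterS hz => -[x m] [/= xd]; rewrite geq_max => /andP[Nm qm].
rewrite /P cn_ltE.
have := sE m (pickle q) qm; rewrite /pt pickleK.
have xt := polydisc_le dt xd; have qt := polydisc_le dt hq.
rewrite v'E// => k1.
have k2 : 1 / 2 ^+ m <= 1 / 2 ^+ N :> R.
  by rewrite !mul1r lef_pV2 ?posrE ?exprn_gt0// ler_eXn2l ?ltr1n.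
have xq i : cn (rat_point q 0 i - x 0 i) <= 2 * d.
  have := cn_tri (z 0 i) (rat_point q 0 i) (x 0 i); have := xd i; have := hq i.
  by rewrite (cnB (z 0 i)); lra.
have := vlip (sigma m) x _ _ xt qt xq; have := Glip x _ _ xt qt xq.
set p := rat_point q in k1 *; rewrite (cnB (v _ p)) => k3 k4.
have := cn_tri (v (sigma m) p) (v (sigma m) x) (G x).
have := cn_tri (G p) (v (sigma m) p) (G x).
by have := mulr_ge0 L0 (ltW d0); lra.
Qed.

End Globalization.

(** * Divergence or boundedness at one base point *)

Theorem theorem6 (R : realType) (n : nat) (D : set 'rV[R[i]]_n)
    (F : set ('rV[R[i]]_n -> R[i])) (k : nat) :
  domain D -> (0 < k)%N ->
  (forall f, F f -> holomorphic_on D f) ->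
  (forall f, F f -> forall z, D z -> forall v : 'rV[R[i]]_n,
      eucl_norm v = 1 -> f z != 0 /\ Dk_pair k f z v != 1) ->
  normal_family D F.
Proof.
move=> [oD [cD [z0 Dz0]]] k0 hol test u Fu.
have harnack z : D z -> exists2 rho, 0 < rho & forall A, exists B, forall f, F f ->
    forall x y, polydisc z rho x -> polydisc z rho y -> cn (f x) <= A -> cn (f y) <= B.
  move=> Dz; have /nbhs_polydisc[r r0 rD] : nbhs z D by move: oD; rewrite openE => /(_ _ Dz).
  have [rho rho0 [_ h]] := local_harnack k r0 rD; exists rho => // A.
  have [B hB] := h A; exists B => f Ff; apply: hB; first exact: hol.
  by move=> w i Dw; apply: unit_vector_test => v; apply: test.
have [inf|bdd] := pselect (forall A, exists N, forall m, (N <= m)%N -> A < cn (u m z0)).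
  exists id; split=> //; right=> K KD /compact_near_coveringP cK M.
  pose S := [set z | forall A, exists N, forall m, (N <= m)%N -> A < cn (u m z)].
  have Sall z : D z -> S z.
    apply: (@connected_propagate R n D S oD cD _ z0) => // w Dw.
    have [rho rho0 h] := harnack w Dw; exists rho => // x y xr yr Sx A.
    (* The Harnack bound is used backwards: a value at most [A] at [y] would force one at most [B]
       at [x]. *)
    have [B hB] := h A; have [N hN] := Sx B; exists N => m Nm.
    by rewrite ltNge; apply/negP => /(hB _ (Fu m) _ _ yr xr); apply/negP; rewrite -ltNge hN.
  pose P m z := (M%:C)%C < `|u m z|.
  suff : \forall m \near \oo, K `<=` P m by apply: filterS => m h x /h.
  apply: cK => z Kz; have Dz := KD z Kz.
  have [rho rho0 h] := harnack z Dz; have [B hB] := h M; have [N hN] := Sall z Dz B.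
  have hz : \forall x \near z & m \near \oo, polydisc z rho x /\ (N <= m)%N.
    exists (polydisc z rho, [set m | (N <= m)%N]) => /=.
      split; first by apply/nbhs_polydisc; exists rho.
      by exists N.
    by case=> x m [].
  apply: filterS hz => -[x m] [/= xr Nm]; rewrite /P cn_norm ltcR ltNge; apply/negP.
  move=> /(hB _ (Fu m) _ _ xr (polydisc_center z rho0)); apply/negP.
  by rewrite -ltNge hN.
(* Failure of divergence at [z0] gives a bound met infinitely often, hence a subsequence bounded at
   [z0]. *)
have [A hA] : exists A, forall N, exists2 m, (N <= m)%N & cn (u m z0) <= A.
  move/existsNP : bdd => [A hA]; exists A => N.
  move/forallNP : hA => /(_ N) /existsNP[m /not_implyP[Nm /negP]].
  by rewrite -leNgt => ?; exists m.
have [|tau tauS tauA] := @extract_subsequence (fun _ m => cn (u m z0) <= A).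
  by move=> _ N; apply: hA.
pose S := [set z | exists B, forall m, cn (u (tau m) z) <= B].
have Sall z : D z -> S z.
  apply: (@connected_propagate R n D S oD cD _ z0) => //; last by exists A.
  move=> w Dw; have [rho rho0 h] := harnack w Dw; exists rho => // x y xr yr [C hC].
  by have [B hB] := h C; exists B => m; apply: hB xr yr (hC m).
have [||sigma sigmaS [g hg]] := @locally_bounded_subsequence R n D (fun m => u (tau m)) oD.
- by move=> m; apply: hol.
- move=> z Dz; have [rho rho0 h] := harnack z Dz; have [C hC] := Sall z Dz.
  have [B hB] := h C; exists rho => //; exists B => m x xr.
  exact: hB _ (Fu _) _ _ (polydisc_center z rho0) xr (hC m).
exists (tau \o sigma); split; last by left; exists g.
have tau_lt : {homo tau : a b / (a < b)%N} := homo_ltn ltn_trans tauS.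
by move=> m /=; apply/tau_lt/sigmaS.
Qed.
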